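(* Let $G$ be a finite group, $\mathcal Y\to\mathcal B$ a $G$-gerbe over an orbifold $\mathcal B$, $\widehat{\mathcal Y}$ its dual orbifold and $c$ the associated flat $U(1)$-gerbe on $\widehat{\mathcal Y}$. Then the abelian category of sheaves on $\mathcal Y$ is equivalent to the abelian category of $c$-twisted sheaves on $\widehat{\mathcal Y}$.
   Context: Sheaves are sheaves of complex vector spaces. Groupoid presentation: $\mathcal Y$ and $\mathcal B$ are presented by proper étale Lie groupoids $\mathfrak H,\mathfrak Q$ with $\mathfrak H_0=\mathfrak Q_0=M$, fitting in an exact sequence $M\times G\to\mathfrak H\xrightarrow{j}\mathfrak Q$ ($j$ is a surjective groupoid morphism, the kernel of $j$ is the trivial bundle of groups $M\times G$), both maps being the identity on $M$, such that (after refining) every level of the nerve of $\mathfrak Q$ is a disjoint union of contractible open sets. An arrow $q$ has source $s(q)$ and target $t(q)$; $q_1q_2$ is defined when $t(q_1)=s(q_2)$ and has source $s(q_1)$, target $t(q_2)$. Fix a smooth section $\sigma:\mathfrak Q\to\mathfrak H$ of $j$ that is the identity on $M$, and put $\tau(q_1,q_2)=\sigma(q_1)\sigma(q_2)\sigma(q_1q_2)^{-1}\in G$, $\mathrm{Ad}_{\sigma(q)}(g)=\sigma(q)g\sigma(q)^{-1}\in G$. Cocycle: $\widehat G$ is the finite set of isomorphism classes of irreducible unitary $G$-representations, with fixed representatives $\rho:G\to\mathrm{End}(V_\rho)$. For $q\in\mathfrak Q$, $q([\rho])$ is the class of $\rho\circ\mathrm{Ad}_{\sigma(q)}$, so $(q_1q_2)([\rho])=q_2(q_1([\rho]))$;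 the chosen representative of this class is also written $q([\rho])$. Choose unitary $T_q^{[\rho]}:V_\rho\to V_{q([\rho])}$, locally constant in $q$, with $\rho(\mathrm{Ad}_{\sigma(q)}(g))=(T_q^{[\rho]})^{-1}q([\rho])(g)T_q^{[\rho]}$ and $T_q^{[\rho]}=\mathrm{id}$ for units $q$. Then $c^{[\rho]}(q_1,q_2)\in U(1)$ is defined by $T_{q_2}^{q_1([\rho])}T_{q_1}^{[\rho]}=c^{[\rho]}(q_1,q_2)T_{q_1q_2}^{[\rho]}\rho(\tau(q_1,q_2))^{-1}$; it is a locally constant $2$-cocycle on the groupoid $\widehat G\rtimes\mathfrak Q$ with objects $\widehat G\times M$ and arrows $([\rho],q)$ from $([\rho],s(q))$ to $(q([\rho]),t(q))$, $([\rho],q_1)(q_1([\rho]),q_2)=([\rho],q_1q_2)$. The dual orbifold $\widehat{\mathcal Y}$ is the orbifold presented by $\widehat G\rtimes\mathfrak Q$, and the $U(1)$-gerbe $c$ on it is the one given by this cocycle. Sheaves on $\mathcal Y$ are $\mathfrak H$-sheaves: sheaves $\mathcal S$ on $\mathfrak H_0=M$ with an action $\hat g:\mathcal S_y\to\mathcal S_x$ for each arrow $g:x\to y$ (continuous in $g$) with $\widehat{gh}=\hat g\circ\hat h$. $c$-twisted sheaves on $\widehat{\mathcal Y}$ are $c$-twisted $\widehat G\rtimes\mathfrak Q$-sheaves: sheaves on $\widehat G\times M$ with such maps $\hat g$ satisfying instead $\hat g_1\circ\hat g_2=c(g_1,g_2)\widehat{g_1g_2}$. *)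

(* Defs.v *)
From HB Require Import structures.
From mathcomp Require Import all_boot all_order all_algebra all_fingroup.
From mathcomp Require Import all_character complex.
From mathcomp Require Import all_classical all_reals all_analysis.

Set Implicit Arguments.
Unset Strict Implicit.
Unset Printing Implicit Defensive.

Import Order.TTheory GRing.Theory Num.Theory.
Import numFieldNormedType.Exports.

Local Open Scope classical_set_scope.
Local Open Scope ring_scope.
Local Open Scope complex_scope.
Local Open Scope sesquilinear_scope.

Record preadditive := Preadditive {
  ob :> Type;
  hom : ob -> ob -> zmodType;
  idc : forall A, hom A A;
  compc : forall A B C, hom B C -> hom A B -> hom A C;
  compcA : forall A B C D (h : hom C D) (g : hom B C) (f : hom A B),
    compc h (compc g f) = compc (compc h g) f;
  comp1c : forall A B (f : hom A B), compc (idc B) f = f;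
  compc1 : forall A B (f : hom A B), compc f (idc A) = f;
  compcDl : forall A B C (g g' : hom B C) (f : hom A B),
    compc (g + g') f = compc g f + compc g' f;
  compcDr : forall A B C (g : hom B C) (f f' : hom A B),
    compc g (f + f') = compc g f + compc g f'
}.

Record additive_functor (A B : preadditive) := AdditiveFunctor {
  fob :> A -> B;
  fmap : forall X Y, hom X Y -> hom (fob X) (fob Y);
  fmap_id : forall X, fmap (idc X) = idc (fob X);
  fmap_comp : forall X Y Z (g : hom Y Z) (f : hom X Y),
    fmap (compc g f) = compc (fmap g) (fmap f);
  fmapD : forall X Y (f g : hom X Y), fmap (f + g) = fmap f + fmap g
}.

Definition is_iso (A : preadditive) (X Y : A) (f : hom X Y) : Prop :=
  exists g : hom Y X, compc g f = idc X /\ compc f g = idc Y.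

(* [F] and [G] are quasi-inverse: there are natural isomorphisms
   [1 -> G F] and [F G -> 1]. *)
Definition quasi_inverse (A B : preadditive)
    (F : additive_functor A B) (G : additive_functor B A) : Prop :=
  (exists eta : forall X : A, hom X (G (F X)),
     (forall X, is_iso (eta X)) /\
     forall (X Y : A) (f : hom X Y),
       compc (fmap G (fmap F f)) (eta X) = compc (eta Y) f) /\
  (exists eps : forall X : B, hom (F (G X)) X,
     (forall X, is_iso (eps X)) /\
     forall (X Y : B) (f : hom X Y),
       compc f (eps X) = compc (eps Y) (fmap F (fmap G f))).

Definition equivalent (A B : preadditive) : Prop :=
  exists (F : additive_functor A B) (G : additive_functor B A),
    quasi_inverse F G.

(* For finite-dimensional [V] and open [U], this is C^k on [U]. *)
Fixpoint Ck_on (R : realType) (V W : normedModType R) (k : nat)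
    (U : set V) (f : V -> W) : Prop :=
  match k with
  | 0 => forall x, U x -> {for x, continuous f}
  | k'.+1 => (forall x, U x -> differentiable f x) /\
             forall v : V, Ck_on k' U (fun x => 'D_v f x)
  end.

Definition Cinfty_on (R : realType) (V W : normedModType R)
    (U : set V) (f : V -> W) : Prop := forall k, Ck_on k U f.

(* A chart of [X] with values in [V]; [cinv] matters only on the image of
   [cdom] and [cmap] only on [cdom]. *)
Record chart (X V : Type) := Chart {
  cdom : set X;
  cmap : X -> V;
  cinv : V -> X
}.

Definition is_chart (X V : topologicalType) (a : chart X V) : Prop :=
  [/\ open (cdom a), open (cmap a @` cdom a),
      forall x, cdom a x -> cinv a (cmap a x) = x,
      forall x, cdom a x -> {for x, continuous (cmap a)} &
      forall v, (cmap a @` cdom a) v -> {for v, continuous (cinv a)}].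

Definition is_atlas (R : realType) (X : topologicalType) (V : normedModType R)
    (A : set (chart X V)) : Prop :=
  [/\ forall a, A a -> is_chart a,
      forall x, exists2 a, A a & cdom a x &
      forall a b, A a -> A b ->
        Cinfty_on (cmap a @` (cdom a `&` cdom b)) (cmap b \o cinv a)].

(* The smooth structure is the one generated by [A], which need not be a
   maximal atlas. *)
Definition is_manifold (R : realType) (n : nat) (X : topologicalType)
    (A : set (chart X 'rV[R]_n)) : Prop :=
  [/\ hausdorff_space X, @second_countable X & is_atlas A].

Definition prod_chart (X Y V W : Type) (a : chart X V) (b : chart Y W) :
    chart (X * Y) (V * W) :=
  Chart (cdom a `*` cdom b) (fun p => (cmap a p.1, cmap b p.2))
        (fun v => (cinv a v.1, cinv b v.2)).

Definition prod_atlas (X Y V W : Type)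
    (A : set (chart X V)) (B : set (chart Y W)) :
    set (chart (X * Y) (V * W)) :=
  [set c | exists a b, [/\ A a, B b & c = prod_chart a b]].

Definition smooth_on (R : realType) (X Y : topologicalType)
    (V W : normedModType R) (A : set (chart X V)) (B : set (chart Y W))
    (U : set X) (f : X -> Y) : Prop :=
  (forall x, U x -> {for x, continuous f}) /\
  forall a b, A a -> B b ->
    Cinfty_on (cmap a @` (U `&` cdom a `&` f @^-1` cdom b))
              (cmap b \o f \o cinv a).

(* [f] is defined on an arbitrary subset [P] of [X] and is smooth when it is
   locally the restriction of a smooth map defined on an open subset of [X].
   This applies to the composition of an etale groupoid, whose domain is a
   submanifold of the product. *)
Definition smooth_sub (R : realType) (X Y : topologicalType)
    (V W : normedModType R) (A : set (chart X V)) (B : set (chart Y W))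
    (P : X -> Prop) (f : forall x, P x -> Y) : Prop :=
  forall x, P x -> exists (U : set X) (F : X -> Y),
    [/\ open U, U x, smooth_on A B U F &
        forall y (Py : P y), U y -> F y = f y Py].

Definition local_diffeo (R : realType) (X Y : topologicalType)
    (V W : normedModType R) (A : set (chart X V)) (B : set (chart Y W))
    (f : X -> Y) : Prop :=
  forall x, exists (U : set X) (g : Y -> X),
    [/\ open U /\ U x, open (f @` U), forall y, U y -> g (f y) = y,
        smooth_on A B U f & smooth_on B A (f @` U) g].

Definition proper_map (X Y : topologicalType) (f : X -> Y) : Prop :=
  continuous f /\ forall K : set Y, compact K -> compact (f @^-1` K).

Definition homset (X A : Type) (s t : A -> X) (x y : X) : Type :=
  {g : A | s g = x /\ t g = y}.

(* A groupoid whose sets of objects and arrows carry topologies. The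
   composite [gcomp g h] is defined when the target of [g] is the source of
   [h]. No continuity is required at this point. *)
Record groupoid (X : topologicalType) := Groupoid {
  arr : topologicalType;
  src : arr -> X;
  tgt : arr -> X;
  ghom := homset src tgt;
  gid : forall x, ghom x x;
  gcomp : forall x y z, ghom x y -> ghom y z -> ghom x z;
  ginv : forall x y, ghom x y -> ghom y x;
  gcompA : forall x y z w (f : ghom x y) (g : ghom y z) (h : ghom z w),
    gcomp f (gcomp g h) = gcomp (gcomp f g) h;
  gcomp1g : forall x y (f : ghom x y), gcomp (gid x) f = f;
  gcompg1 : forall x y (f : ghom x y), gcomp f (gid y) = f;
  gcompgV : forall x y (f : ghom x y), gcomp f (ginv f) = gid x;
  gcompVg : forall x y (f : ghom x y), gcomp (ginv f) f = gid y
}.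
Arguments gid {X} _ x.

Section GroupoidTheory.
Variables (X : topologicalType) (K : groupoid X).

Definition as_hom (g : arr K) : ghom K (src g) (tgt g) :=
  exist _ g (conj erefl erefl).

Definition unit_arr (x : X) : arr K := sval (gid K x).

Definition inv_arr (g : arr K) : arr K := sval (ginv (as_hom g)).

Definition composable (p : arr K * arr K) : Prop := tgt p.1 = src p.2.

Definition comp_arr (p : arr K * arr K) (e : composable p) : arr K :=
  sval (gcomp (as_hom p.1)
              (exist _ p.2 (conj (esym e) erefl) : ghom K (tgt p.1) (tgt p.2))).

Lemma homset_inj x y (f g : ghom K x y) : sval f = sval g -> f = g.
Proof.
case: f g => [f Pf] [g Pg] /= fg; subst g.
by congr exist; exact: Prop_irrelevance.
Qed.

(* The level [k] of the nerve is a subset of [nerve_space k]: strings of [k]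
   composable arrows, given by the source of the first arrow followed by the
   arrows. *)
Fixpoint nerve_space (k : nat) : topologicalType :=
  match k with
  | 0 => X
  | k'.+1 => (nerve_space k' * arr K)%type
  end.

Definition nerve_end (k : nat) : nerve_space k -> X :=
  match k with
  | 0 => fun x => x
  | k'.+1 => fun p => tgt p.2
  end.

Fixpoint nerve (k : nat) : set (nerve_space k) :=
  match k with
  | 0 => setT
  | k'.+1 => [set p | nerve p.1 /\ nerve_end p.1 = src p.2]
  end.

End GroupoidTheory.
Arguments nerve {X} K k _ : rename.

(* Source and target are local diffeomorphisms, so objects and arrows have the
   same dimension [n]. *)
Definition proper_etale_lie (R : realType) (n : nat) (X : topologicalType)
    (AX : set (chart X 'rV[R]_n)) (K : groupoid X)
    (AK : set (chart (arr K) 'rV[R]_n)) : Prop :=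
  [/\ is_manifold AX /\ is_manifold AK,
      local_diffeo AK AX (@src X K) /\ local_diffeo AK AX (@tgt X K),
      smooth_on AX AK setT (@unit_arr X K) /\
        smooth_on AK AK setT (@inv_arr X K),
      smooth_sub (prod_atlas AK AK) AK (@comp_arr X K) &
      proper_map (fun g : arr K => (src g, tgt g))].

Definition contractible (R : realType) (X : topologicalType) (A : set X) :
    Prop :=
  exists a, A a /\ exists h : R * X -> X,
    [/\ {within `[0, 1]%classic `*` A, continuous h},
        forall p, (`[0, 1]%classic `*` A) p -> A (h p),
        forall x, A x -> h (0, x) = x &
        forall x, A x -> h (1, x) = a].

Definition union_of_contractibles (R : realType) (X : topologicalType)
    (N : set X) : Prop :=
  exists (I : Type) (U : I -> set X),
    [/\ \bigcup_i U i = N,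
        forall i, exists2 W, open W & U i = W `&` N,
        forall i j, U i `&` U j !=set0 -> i = j &
        forall i, contractible R (U i)].

Record gerbe_presentation (R : realType) (G : finGroupType) := Gerbe {
  gdim : nat;
  gM : topologicalType;
  gMatlas : set (chart gM 'rV[R]_gdim);
  gH : groupoid gM;
  gHatlas : set (chart (arr gH) 'rV[R]_gdim);
  gQ : groupoid gM;
  gQatlas : set (chart (arr gQ) 'rV[R]_gdim);
  gH_lie : proper_etale_lie gMatlas gHatlas;
  gQ_lie : proper_etale_lie gMatlas gQatlas;
  gj : forall x y, ghom gH x y -> ghom gQ x y;
  gj_smooth : smooth_on gHatlas gQatlas setT (fun h => sval (gj (as_hom h)));
  gj_id : forall x, gj (gid gH x) = gid gQ x;
  gj_comp : forall x y z (f : ghom gH x y) (g : ghom gH y z),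
    gj (gcomp f g) = gcomp (gj f) (gj g);
  gj_surj : forall x y (q : ghom gQ x y), exists h, gj h = q;
  (* [gi] is the inclusion M x G -> H of the kernel of [gj]; as a manifold,
     M x G is a disjoint union of copies of M indexed by G *)
  gi : forall x, G -> ghom gH x x;
  gi_smooth : forall g : G,
    smooth_on gMatlas gHatlas setT (fun x => sval (gi x g));
  giM : forall x (g h : G), gi x (g * h)%g = gcomp (gi x g) (gi x h);
  gi_inj : forall x, injective (gi x);
  gi_exact : forall x (h : ghom gH x x),
    gj h = gid gQ x <-> exists g, gi x g = h;
  gQ_nerve : forall k, union_of_contractibles R (nerve gQ k)
}.

Record gerbe_section (R : realType) (G : finGroupType)
    (Y : gerbe_presentation R G) := GerbeSection {
  gsec :> forall x y, ghom (gQ Y) x y -> ghom (gH Y) x y;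
  gsec_smooth : smooth_on (@gQatlas R G Y) (@gHatlas R G Y) setT
                  (fun q => sval (gsec (as_hom q)));
  gsecK : forall x y (q : ghom (gQ Y) x y), gj (gsec q) = q;
  gsec_id : forall x, gsec (gid (gQ Y) x) = gid (gH Y) x
}.

(* The representation acts on column vectors of height [rdeg]. *)
Record unitary_irrep (R : realType) (G : finGroupType) := UnitaryIrrep {
  rdeg : nat;
  rrep :> mx_representation R[i] [set: G]%G rdeg;
  rrep_irr : mx_irreducible rrep;
  rrep_unitary : forall g, rrep g \is unitarymx
}.

(* [dcar] is the set of isomorphism classes, [dclass] the quotient map and
   [drepr] the choice of representatives. *)
Record unitary_dual (R : realType) (G : finGroupType) := UnitaryDual {
  dcar :> finType;
  dclass : unitary_irrep R G -> dcar;
  dclass_eq : forall r r', dclass r = dclass r' <-> mx_rsim r r';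
  drepr : dcar -> unitary_irrep R G;
  dreprK : cancel drepr dclass
}.

Section Dual.
Variables (R : realType) (G : finGroupType) (Y : gerbe_presentation R G).
Variables (s : gerbe_section Y) (D : unitary_dual R G).
Local Notation M := (gM Y).
Local Notation H := (gH Y).
Local Notation Q := (gQ Y).

(* The element of G corresponding to an element of the kernel of H -> Q. *)
Definition ker_elt (x : M) (h : ghom H x x) : G :=
  xget 1%g [set g | gi x g = h].

Definition Ad (x y : M) (q : ghom Q x y) (g : G) : G :=
  ker_elt (gcomp (gcomp (s _ _ q) (gi y g)) (ginv (s _ _ q))).

Definition tau (x y z : M) (q1 : ghom Q x y) (q2 : ghom Q y z) : G :=
  ker_elt (gcomp (gcomp (s _ _ q1) (s _ _ q2)) (ginv (s _ _ (gcomp q1 q2)))).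

Lemma ker_eltK x (h : ghom H x x) : gj h = gid Q x -> gi x (ker_elt h) = h.
Proof.
move=> /gi_exact[g gh]; rewrite /ker_elt.
by case: xgetP => [k _ //|/(_ g)]; rewrite /= gh.
Qed.

Lemma gj_inv x y (h : ghom H x y) : gj (ginv h) = ginv (gj h).
Proof.
rewrite -[LHS]gcomp1g -(gcompVg (gj h)) -gcompA -gj_comp gcompgV gj_id.
by rewrite gcompg1.
Qed.

Lemma gj_gi (x : M) g : gj (gi x g) = gid Q x.
Proof. by apply/gi_exact; exists g. Qed.

Lemma gi1 (x : M) : gi x 1%g = gid H x.
Proof.
rewrite -(gcompgV (gi x 1%g)) -{2}(mulg1 (1%g : G)) giM -gcompA.
by rewrite gcompgV gcompg1.
Qed.

Lemma giV (x : M) g : gi x g^-1%g = ginv (gi x g).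
Proof.
rewrite -[LHS]gcompg1 -(gcompgV (gi x g)) gcompA -giM mulVg gi1.
by rewrite gcomp1g.
Qed.


Lemma gi_Ad x y (q : ghom Q x y) g :
  gi x (Ad q g) = gcomp (gcomp (s _ _ q) (gi y g)) (ginv (s _ _ q)).
Proof.
apply: ker_eltK.
by rewrite !gj_comp gj_gi gj_inv gsecK gcompg1 gcompgV.
Qed.

Lemma gi_tau x y z (q1 : ghom Q x y) (q2 : ghom Q y z) :
  gi x (tau q1 q2) =
  gcomp (gcomp (s _ _ q1) (s _ _ q2)) (ginv (s _ _ (gcomp q1 q2))).
Proof. by apply: ker_eltK; rewrite !gj_comp gj_inv !gsecK gcompgV. Qed.

Lemma Ad_swap x y (q : ghom Q x y) g :
  gcomp (gi x (Ad q g)) (s _ _ q) = gcomp (s _ _ q) (gi y g).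
Proof. by rewrite gi_Ad -gcompA gcompVg gcompg1. Qed.

Lemma tau_swap x y z (q1 : ghom Q x y) (q2 : ghom Q y z) :
  gcomp (gi x (tau q1 q2)) (s _ _ (gcomp q1 q2)) =
  gcomp (s _ _ q1) (s _ _ q2).
Proof. by rewrite gi_tau -gcompA gcompVg gcompg1. Qed.

Lemma gcompIr x y z (h : ghom H y z) : injective (fun f : ghom H x y => gcomp f h).
Proof.
move=> f g /(congr1 (fun k => gcomp k (ginv h))).
by rewrite -!gcompA gcompgV !gcompg1.
Qed.

Lemma AdM x y (q : ghom Q x y) : {morph Ad q : g h / (g * h)%g}.
Proof.
move=> g h; apply: (@gi_inj _ _ Y x); apply: (@gcompIr _ _ _ (s _ _ q)).
by rewrite /= Ad_swap !giM -gcompA Ad_swap !gcompA Ad_swap.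
Qed.

Lemma Ad_id x g : Ad (gid Q x) g = g.
Proof.
apply: (@gi_inj _ _ Y x); apply: (@gcompIr _ _ _ (s _ _ (gid Q x))).
by rewrite /= Ad_swap gsec_id gcompg1 gcomp1g.
Qed.

Lemma Ad_comp x y z (q1 : ghom Q x y) (q2 : ghom Q y z) g :
  (Ad q1 (Ad q2 g) * tau q1 q2 = tau q1 q2 * Ad (gcomp q1 q2) g)%g.
Proof.
apply: (@gi_inj _ _ Y x); apply: (@gcompIr _ _ _ (s _ _ (gcomp q1 q2))).
rewrite /= !giM -!gcompA Ad_swap tau_swap !gcompA tau_swap Ad_swap.
by rewrite -!gcompA Ad_swap.
Qed.

Lemma Ad1 x y (q : ghom Q x y) : Ad q 1%g = 1%g.
Proof. by apply: (@mulgI _ (Ad q 1%g)); rewrite -AdM !mulg1. Qed.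

Lemma Ad_surj x y (q : ghom Q x y) k : exists g, Ad q g = k.
Proof.
pose h := gcomp (gcomp (ginv (s _ _ q)) (gi x k)) (s _ _ q).
have hK : gj h = gid Q y.
  by rewrite !gj_comp gj_gi gj_inv gsecK gcompg1 gcompVg.
exists (ker_elt h); apply: (@gi_inj _ _ Y x).
apply: (@gcompIr _ _ _ (s _ _ q)); rewrite /= Ad_swap ker_eltK //.
by rewrite /h !gcompA gcompgV gcomp1g.
Qed.

Section TwistRep.
Variables (r : unitary_irrep R G) (x y : M) (q : ghom Q x y).

Lemma twist_repr : mx_repr [set: G]%G (fun g => r (Ad q g)).
Proof.
split=> [|g h _ _]; first by rewrite Ad1 repr_mx1.
by rewrite AdM repr_mxM ?inE.
Qed.

Definition twist_rep : mx_representation R[i] [set: G]%G (rdeg r) :=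
  MxRepresentation twist_repr.

Lemma twist_module m (U : 'M[R[i]]_(m, rdeg r)) :
  mxmodule twist_rep U = mxmodule r U.
Proof.
apply/mxmoduleP/mxmoduleP => modU g _; last exact: modU.
by have [k <-] := Ad_surj q g; exact: modU.
Qed.

Lemma twist_irr : mx_irreducible twist_rep.
Proof.
have [m1 nz simr] := rrep_irr r.
split=> [||U]; rewrite ?twist_module//.
exact: simr.
Qed.

Lemma twist_unitary g : twist_rep g \is unitarymx.
Proof. exact: rrep_unitary. Qed.

Definition twist : unitary_irrep R G := UnitaryIrrep twist_irr twist_unitary.

End TwistRep.

(* The action [q([rho])] of arrows of Q on isomorphism classes. *)
Definition dact (x y : M) (q : ghom Q x y) (rho : D) : D :=
  dclass D (twist (drepr rho) q).

Lemma dact_id x rho : dact (gid Q x) rho = rho.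
Proof.
rewrite -[RHS](dreprK rho); apply/dclass_eq; exists 1%:M => // [|g _].
  by rewrite row_free_unit unitmx1.
by rewrite mulmx1 mul1mx /= Ad_id.
Qed.

Lemma dact_comp x y z (q1 : ghom Q x y) (q2 : ghom Q y z) rho :
  dact (gcomp q1 q2) rho = dact q2 (dact q1 rho).
Proof.
apply/dclass_eq.
set r1 := drepr (dact q1 rho).
have [B dB fB BM] : mx_rsim (twist (drepr rho) q1) r1.
  by apply/(@dclass_eq _ _ D); rewrite dreprK.
have U k : drepr rho k \in unitmx by apply: repr_mx_unit; rewrite inE.
have sim2 : mx_rsim (twist (drepr rho) (gcomp q1 q2))
                    (twist (twist (drepr rho) q1) q2).
  exists (invmx (drepr rho (tau q1 q2))) => // [|g _].
    by rewrite row_free_unit unitmx_inv.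
  rewrite /=; apply: (can_inj (mulKmx (U (tau q1 q2)))).
  apply: (can_inj (mulmxK (U (tau q1 q2)))).
  rewrite -!mulmxA mulVmx // mulmx1 !mulmxA mulmxV // mul1mx.
  by rewrite -!repr_mxM ?inE // Ad_comp.
apply: mx_rsim_trans sim2 _.
by exists B => // g _; exact: BM.
Qed.

Lemma dact_inv x y (q : ghom Q x y) rho : dact (ginv q) (dact q rho) = rho.
Proof. by rewrite -dact_comp gcompgV dact_id. Qed.

Local Notation dobj := (discrete_topology D * M)%type.
Local Notation darr := (discrete_topology D * arr Q)%type.

Definition dsrc (a : darr) : dobj := (a.1, src a.2).
Definition dtgt (a : darr) : dobj := (dact (as_hom a.2) a.1, tgt a.2).
Local Notation dhom := (homset dsrc dtgt).

Lemma dact_as_hom x y (q : ghom Q x y) rho :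
  dact (as_hom (sval q)) rho = dact q rho.
Proof. by case: q => q [sq tq] /=; subst x y. Qed.

Lemma dhomP (a b : dobj) (f : dhom a b) :
  [/\ (sval f).1 = a.1, src (sval f).2 = a.2 & tgt (sval f).2 = b.2].
Proof. by case: f => -[r q] [/= <- <-]. Qed.

Definition darrow (a b : dobj) (f : dhom a b) : ghom Q a.2 b.2 :=
  let: And3 _ e1 e2 := dhomP f in exist _ (sval f).2 (conj e1 e2).

Lemma sval_darrow a b (f : dhom a b) : sval (darrow f) = (sval f).2.
Proof. by rewrite /darrow; case: dhomP. Qed.

Lemma darrow_act a b (f : dhom a b) : dact (darrow f) a.1 = b.1.
Proof.
rewrite -dact_as_hom sval_darrow.
by case: f => -[r q] [/= <- <-].
Qed.

Lemma dhom_of_subproof (a b : dobj) (q : ghom Q a.2 b.2) :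
  dact q a.1 = b.1 ->
  dsrc (a.1, sval q) = a /\ dtgt (a.1, sval q) = b.
Proof.
move=> e; rewrite /dsrc /dtgt /= dact_as_hom e.
by case: (svalP q) => -> ->; case: a b {q e} => ? ? [].
Qed.

(* The arrow [([rho], q)] of the dual groupoid. *)
Definition dhom_of (a b : dobj) (q : ghom Q a.2 b.2) (e : dact q a.1 = b.1) :
    dhom a b := exist _ (a.1, sval q) (dhom_of_subproof e).

Definition did (a : dobj) : dhom a a := dhom_of (dact_id a.2 a.1).

Lemma dcomp_subproof (a b c : dobj) (f : dhom a b) (g : dhom b c) :
  dact (gcomp (darrow f) (darrow g)) a.1 = c.1.
Proof. by rewrite dact_comp !darrow_act. Qed.

Definition dcomp (a b c : dobj) (f : dhom a b) (g : dhom b c) : dhom a c :=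
  dhom_of (dcomp_subproof f g).

Lemma dinv_subproof (a b : dobj) (f : dhom a b) :
  dact (ginv (darrow f)) b.1 = a.1.
Proof. by rewrite -(darrow_act f) dact_inv. Qed.

Definition dinv (a b : dobj) (f : dhom a b) : dhom b a :=
  dhom_of (dinv_subproof f).

Lemma darrowK a b (q : ghom Q a.2 b.2) (e : dact q a.1 = b.1) :
  darrow (dhom_of e) = q.
Proof. by apply: homset_inj; rewrite sval_darrow. Qed.

Lemma darrow_inj a b (f g : dhom a b) : darrow f = darrow g -> f = g.
Proof.
move=> /(congr1 sval); rewrite !sval_darrow.
case: (dhomP f) (dhomP g) => f1 _ _ [g1 _ _].
case: f g f1 g1 => [[r q] Pf] [[r' q'] Pg] /= e1 e2 e3; subst.
by congr exist; exact: Prop_irrelevance.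
Qed.

Lemma dcompA a b c d (f : dhom a b) (g : dhom b c) (h : dhom c d) :
  dcomp f (dcomp g h) = dcomp (dcomp f g) h.
Proof. by apply: darrow_inj; rewrite !darrowK gcompA. Qed.

Lemma dcomp1g a b (f : dhom a b) : dcomp (did a) f = f.
Proof. by apply: darrow_inj; rewrite !darrowK gcomp1g. Qed.

Lemma dcompg1 a b (f : dhom a b) : dcomp f (did b) = f.
Proof. by apply: darrow_inj; rewrite !darrowK gcompg1. Qed.

Lemma dcompgV a b (f : dhom a b) : dcomp f (dinv f) = did a.
Proof. by apply: darrow_inj; rewrite !darrowK gcompgV. Qed.

Lemma dcompVg a b (f : dhom a b) : dcomp (dinv f) f = did b.
Proof. by apply: darrow_inj; rewrite !darrowK gcompVg. Qed.

Definition dual_groupoid : groupoid (discrete_topology D * M)%type :=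
  Groupoid dcompA dcomp1g dcompg1 dcompgV dcompVg.

Local Notation deg rho := (rdeg (drepr (rho : D))).

(* [itw e] is the matrix of T_q^[rho], where [e : q([rho]) = rho']. *)
Record intertwiners := Intertwiners {
  itw :> forall (rho rho' : D) (x y : M) (q : ghom Q x y),
    dact q rho = rho' -> 'M[R[i]]_(deg rho', deg rho);
  itw_unitary : forall rho rho' x y (q : ghom Q x y) (e : dact q rho = rho'),
    itw e \is unitarymx /\ (itw e) ^t* \is unitarymx;
  (* the inverse of T is its conjugate transpose *)
  itwE : forall rho rho' x y (q : ghom Q x y) (e : dact q rho = rho') g,
    drepr rho (Ad q g) =
    (itw e) ^t* *m drepr rho' g *m itw e;
  itw_id : forall rho x (e : dact (gid Q x) rho = rho), itw e = 1%:M;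
  itw_locally_constant : forall rho rho' (q0 : arr Q)
      (e0 : dact (as_hom q0) rho = rho'),
    \forall q \near q0,
      exists e : dact (as_hom q) rho = rho', itw e = itw e0
}.

End Dual.

Definition cochain2 (R : realType) (X : topologicalType) (K : groupoid X) :=
  forall x y z : X, ghom K x y -> ghom K y z -> R[i].

Definition trivial_cocycle (R : realType) (X : topologicalType)
    (K : groupoid X) : cochain2 R K := fun _ _ _ _ _ => 1.

Definition is_dual_cocycle (R : realType) (G : finGroupType)
    (Y : gerbe_presentation R G) (s : gerbe_section Y) (D : unitary_dual R G)
    (T : intertwiners s D) (c : cochain2 R (dual_groupoid s D)) : Prop :=
  forall (a1 a2 a3 : discrete_topology D * gM Y)
      (f : ghom (dual_groupoid s D) a1 a2)
      (g : ghom (dual_groupoid s D) a2 a3),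
    `|c _ _ _ f g| = 1 /\
    T _ _ _ _ _ (darrow_act g) *m T _ _ _ _ _ (darrow_act f) =
    c _ _ _ f g *:
      (T _ _ _ _ _ (darrow_act (gcomp f g)) *m
       invmx (drepr a1.1 (tau s (darrow f) (darrow g)))).

(* The topology of the etale space is given by its open sets; it is not the
   disjoint union topology that [{x : X & stalk x}] carries by default, whence
   the alias [espace]. *)
Record bundle (R : realType) (X : topologicalType) := Bundle {
  stalk : X -> lmodType R[i];
  eopen : set_system {x : X & stalk x};
  eopenT : eopen setT;
  eopenI : setI_closed eopen;
  eopen_bigU : forall (I : Type) (f : I -> set {x : X & stalk x}),
    (forall i, eopen (f i)) -> eopen (\bigcup_i f i)
}.

Definition espace (R : realType) (X : topologicalType) (S : bundle R X) :
    Type := {x : X & stalk S x}.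

HB.instance Definition _ R X (S : bundle R X) :=
  Choice.copy (espace S) {x : X & stalk S x}.
HB.instance Definition _ R X (S : bundle R X) :=
  isOpenTopological.Build (espace S) (@eopenT R X S) (@eopenI R X S)
    (@eopen_bigU R X S).

Section Etale.
Variables (R : realType) (X : topologicalType) (S : bundle R X).

Definition germ (x : X) (v : stalk S x) : espace S := existT _ x v.

Definition ebase (e : espace S) : X := projT1 e.

Definition escale (a : R[i]) (e : espace S) : espace S :=
  germ (a *: projT2 e).

(* The fibre product of [espace S] with itself over [X], with the topology
   induced by the product, and the addition map on it. *)
Definition epair_incl (p : {x : X & (stalk S x * stalk S x)%type}) :
    espace S * espace S :=
  (germ (projT2 p).1, germ (projT2 p).2).
Definition epair : topologicalType := initial_topology epair_incl.

Definition eadd (p : epair) : espace S :=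
  germ ((projT2 p).1 + (projT2 p).2).

End Etale.

Definition local_homeo (A B : topologicalType) (f : A -> B) : Prop :=
  continuous f /\
  forall a, exists U : set A,
    [/\ open U, U a, set_inj U f &
        forall W, open W -> W `<=` U -> open (f @` W)].

(* Sheaves of complex vector spaces, as etale spaces. *)
Definition is_sheaf (R : realType) (X : topologicalType) (S : bundle R X) :
    Prop :=
  [/\ local_homeo (@ebase R X S), continuous (@eadd R X S) &
      forall a, continuous (@escale R X S a)].

Section TwistedSheaves.
Variables (R : realType) (X : topologicalType) (K : groupoid X).

(* The fibre product of the arrows and of [espace S] over the target map, with
   the topology induced by the product. *)
Section ActionSpace.
Variable S : bundle R X.
Definition eact_incl (p : {g : arr K & stalk S (tgt g)}) : arr K * espace S :=
  (projT1 p, germ (projT2 p)).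
Definition eact_space : topologicalType := initial_topology eact_incl.
End ActionSpace.

Variable c : cochain2 R K.

Record twisted_sheaf := TwistedSheaf {
  tsheaf :> bundle R X;
  tsheafP : is_sheaf tsheaf;
  tact : forall x y, ghom K x y -> stalk tsheaf y -> stalk tsheaf x;
  tact_linear : forall x y (g : ghom K x y) (a : R[i]) u v,
    tact g (a *: u + v) = a *: tact g u + tact g v;
  tact_id : forall x u, tact (gid K x) u = u;
  tact_comp : forall x y z (g : ghom K x y) (h : ghom K y z) u,
    tact g (tact h u) = c g h *: tact (gcomp g h) u;
  tact_continuous : continuous (fun p : eact_space tsheaf =>
    germ (tact (as_hom (projT1 p)) (projT2 p)) : espace tsheaf)
}.

Record tsheaf_hom (S S' : twisted_sheaf) := TSheafHom {
  tmap :> forall x, stalk S x -> stalk S' x;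
  tmap_linear : forall x (a : R[i]) u v,
    tmap (a *: u + v : stalk S x) = a *: tmap u + tmap v;
  tmap_act : forall x y (g : ghom K x y) u,
    tmap (tact g u : stalk S x) = tact g (tmap u);
  tmap_continuous : continuous (fun e : espace S =>
    germ (tmap (projT2 e)) : espace S')
}.

Section HomGroup.
Variables S S' : twisted_sheaf.
Implicit Types f g h : tsheaf_hom S S'.

Lemma tsheaf_hom_eq f g : (forall x u, f x u = g x u) -> f = g.
Proof.
case: f g => [f Lf Af Cf] [g Lg Ag Cg] /= fg.
have E : f = g by apply: functional_extensionality_dep => x; apply/funext.
by subst g; congr TSheafHom; exact: Prop_irrelevance.
Qed.

Lemma tactZ x y (k : ghom K x y) a (u : stalk S' y) :
  tact k (a *: u) = a *: tact k u.
Proof.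
have t0 : tact k (0 : stalk S' y) = 0.
  have := tact_linear k 1 (0 : stalk S' y) 0.
  rewrite !scale1r addr0 => /(congr1 (fun z => z - tact k 0)).
  by rewrite addrK subrr => <-.
by rewrite -[a *: u]addr0 tact_linear t0 addr0.
Qed.

Lemma tactD x y (k : ghom K x y) (u v : stalk S' y) :
  tact k (u + v) = tact k u + tact k v.
Proof. by rewrite -[u]scale1r tact_linear !scale1r. Qed.

Lemma zero_section_continuous : continuous (fun x : X => germ (0 : stalk S' x)).
Proof.
have [[_ lh] _ sc] := tsheafP S'.
move=> x W /= W0.
have [U [oU Ux _ Uopen]] := lh (germ (0 : stalk S' x)).
have z0 : escale 0 (germ (0 : stalk S' x)) = germ (0 : stalk S' x).
  by rewrite /escale /= scale0r.
have : nbhs (germ (0 : stalk S' x)) (escale 0 @^-1` W).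
  by apply: sc; rewrite z0.
rewrite nbhsE => -[V [oV Vx] VW].
have oB : open (@ebase _ _ S' @` (U `&` V)).
  by apply: Uopen; [exact: openI | move=> ? []].
have : nbhs x (@ebase _ _ S' @` (U `&` V)).
  apply: open_nbhs_nbhs; split => //.
  by exists (germ (0 : stalk S' x)).
apply: filterS => y [[y' v] [_ Ve] /= ey]; subst y'.
by have := VW _ Ve; rewrite /= /escale /= scale0r.
Qed.

Lemma tadd_subproof f g : continuous (fun e : espace S =>
  germ (f _ (projT2 e) + g _ (projT2 e)) : espace S').
Proof.
have [_ ad _] := tsheafP S'.
pose pr (e : espace S) : epair S' :=
  existT (fun x => (stalk S' x * stalk S' x)%type) (projT1 e)
    (f _ (projT2 e), g _ (projT2 e)).
have cpr : continuous pr.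
  apply/continuousP => _ [A oA <-].
  have cfg : continuous (fun e : espace S =>
      (germ (f _ (projT2 e)) : espace S', germ (g _ (projT2 e)) : espace S')).
    move=> e; exact: (cvg_pair (@tmap_continuous _ _ f e)
                               (@tmap_continuous _ _ g e)).
  by move/continuousP: cfg => /(_ A oA).
move=> e; exact: (continuous_comp (cpr e) (ad (pr e))).
Qed.

Definition thom_zero : tsheaf_hom S S'.
Proof.
refine (@TSheafHom S S' (fun x _ => 0) _ _ _).
- by move=> x a u v; rewrite scaler0 addr0.
- by move=> x y k u; rewrite -[0 in RHS](scale0r (0 : stalk S' y)) tactZ scale0r.
- have [[cb _] _ _] := tsheafP S.
  move=> e; exact: (continuous_comp (cb e) (@zero_section_continuous _)).
Defined.

Definition thom_add f g : tsheaf_hom S S'.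
Proof.
refine (@TSheafHom S S' (fun x u => f x u + g x u) _ _ (@tadd_subproof f g)).
- by move=> x a u v; rewrite !tmap_linear scalerDr addrACA.
- by move=> x y k u; rewrite !tmap_act tactD.
Defined.

Definition thom_opp f : tsheaf_hom S S'.
Proof.
refine (@TSheafHom S S' (fun x u => -1 *: f x u) _ _ _).
- by move=> x a u v; rewrite tmap_linear scalerDr !scalerA mulrC.
- by move=> x y k u; rewrite tmap_act tactZ.
- have [_ _ sc] := tsheafP S'.
  move=> e; exact: (continuous_comp (@tmap_continuous _ _ f e) (sc _ _)).
Defined.

Lemma thom_addA : associative thom_add.
Proof. by move=> f g h; apply: tsheaf_hom_eq => x u /=; rewrite addrA. Qed.

Lemma thom_addC : commutative thom_add.
Proof. by move=> f g; apply: tsheaf_hom_eq => x u /=; rewrite addrC. Qed.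

Lemma thom_add0 : left_id thom_zero thom_add.
Proof. by move=> f; apply: tsheaf_hom_eq => x u /=; rewrite add0r. Qed.

Lemma thom_addN : left_inverse thom_zero thom_opp thom_add.
Proof.
by move=> f; apply: tsheaf_hom_eq => x u /=; rewrite scaleN1r addNr.
Qed.

HB.instance Definition _ := gen_eqMixin (tsheaf_hom S S').
HB.instance Definition _ := gen_choiceMixin (tsheaf_hom S S').
HB.instance Definition _ := GRing.isZmodule.Build (tsheaf_hom S S')
  thom_addA thom_addC thom_add0 thom_addN.

End HomGroup.

Definition thom_id (S : twisted_sheaf) : tsheaf_hom S S.
Proof.
refine (@TSheafHom S S (fun x u => u) _ _ _).
- by [].
- by [].
- have -> : (fun e : espace S => germ (projT2 e) : espace S) = id.
    by apply/funext; case.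
  by move=> e; exact: cvg_id.
Defined.

Definition thom_comp (S1 S2 S3 : twisted_sheaf) (g : tsheaf_hom S2 S3)
  (f : tsheaf_hom S1 S2) : tsheaf_hom S1 S3.
Proof.
refine (@TSheafHom S1 S3 (fun x u => g x (f x u)) _ _ _).
- by move=> x a u v; rewrite !tmap_linear.
- by move=> x y k u; rewrite !tmap_act.
- move=> e; exact: (continuous_comp (@tmap_continuous _ _ f e)
    (@tmap_continuous _ _ g _)).
Defined.

Lemma thom_compA (A B C D : twisted_sheaf) (h : tsheaf_hom C D)
    (g : tsheaf_hom B C) (f : tsheaf_hom A B) :
  thom_comp h (thom_comp g f) = thom_comp (thom_comp h g) f.
Proof. exact: tsheaf_hom_eq. Qed.

Lemma thom_comp1c A B (f : tsheaf_hom A B) : thom_comp (thom_id B) f = f.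
Proof. exact: tsheaf_hom_eq. Qed.

Lemma thom_compc1 A B (f : tsheaf_hom A B) : thom_comp f (thom_id A) = f.
Proof. exact: tsheaf_hom_eq. Qed.

Lemma thom_compDl A B C (g g' : tsheaf_hom B C) (f : tsheaf_hom A B) :
  thom_comp (g + g') f = thom_comp g f + thom_comp g' f.
Proof. exact: tsheaf_hom_eq. Qed.

Lemma thom_compDr A B C (g : tsheaf_hom B C) (f f' : tsheaf_hom A B) :
  thom_comp g (f + f') = thom_comp g f + thom_comp g f'.
Proof.
apply: tsheaf_hom_eq => x u /=.
by rewrite -[f x u]scale1r tmap_linear !scale1r.
Qed.

Definition twisted_sheaves : preadditive :=
  @Preadditive twisted_sheaf tsheaf_hom thom_id thom_comp
    thom_compA thom_comp1c thom_compc1 thom_compDl thom_compDr.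

End TwistedSheaves.

Definition sheaves (R : realType) (X : topologicalType) (K : groupoid X) :
    preadditive := twisted_sheaves (@trivial_cocycle R X K).

(* Main.v *)
From HB Require Import structures.
Require Import Defs.
From mathcomp Require Import all_boot all_order all_algebra all_fingroup.
From mathcomp Require Import all_solvable all_character complex.
From mathcomp Require Import all_classical all_reals all_analysis.

Set Implicit Arguments.
Unset Strict Implicit.
Unset Printing Implicit Defensive.

Import Order.TTheory GRing.Theory Num.Theory.
Import numFieldNormedType.Exports.

Local Open Scope classical_set_scope.
Local Open Scope ring_scope.
Local Open Scope complex_scope.
Local Open Scope sesquilinear_scope.

(** The stalk [S_x] of a sheaf on the gerbe is a representation of [G], through
    the kernel of [H -> Q], so that it decomposes as
    [S_x = (+)_rho V_rho (x) Hom_G(V_rho, S_x)].  This gives two functors.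

    - [mult_functor] sends [S] to the sheaf of multiplicity spaces
      [F(S)_(rho,x) = Hom_G(V_rho, S_x)].  The arrow [([rho], q)] acts by
      [phi |-> sigma(q) o phi o T_q^rho].  In composing two such maps,
      [sigma(q1) sigma(q2) = tau(q1,q2) sigma(q1 q2)] and
      [T_q2 T_q1 = c(q1,q2) T_(q1 q2) rho(tau(q1,q2))^-1]; the element
      [tau(q1,q2)] cancels because [phi] is equivariant, and the scalar
      [c(q1,q2)] is left over.  Hence [F(S)] is twisted by [c].
    - [ind_functor] sends a twisted sheaf [E] to
      [G(E)_x = (+)_rho V_rho (x) E_(rho,x)].  Every arrow of [H] is uniquely
      [g sigma(q)] with [g] in [G], and it acts by
      [v (x) e |-> rho(g) (T_q^rho)^-1 v (x) q e].

    The natural isomorphisms are the evaluation [counit],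
    [V_rho (x) Hom_G(V_rho, S_x) -> S_x], and its counterpart [unit_hom], which
    sends [e] in [E_(rho,x)] to [v |-> v (x) e].  That they are bijective on
    stalks amounts to two facts on matrix coefficients, Schur orthogonality
    ([schur_orthogonality], [schur_orthogonality_neq]) and the expansion of the
    delta function at the unit in irreducible characters ([sum_characters]).
    A bijective morphism of sheaves is an isomorphism ([bijective_is_iso]).

    The topologies are handled through local sections.  In an etale space two
    continuous sections which agree at a point agree around it, and there is a
    continuous section through every point; conversely, a class of germs of
    sections with these properties which is stable under linear combinations
    defines a sheaf ([section_bundle]).  The two functors are defined by
    requiring that the finitely many coordinates of a section be continuous, and
    each continuity statement reduces to the continuity of coordinates, given
    that [T_q] and the component in [G] of an arrow of [H] are locally constant
    ([fibre_elt_locally_constant]). *)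

(** * Matrix coefficients of the irreducible representations *)

Section SchurOrthogonality.
Variables (R : realType) (G : finGroupType) (D : unitary_dual R G).
Implicit Types rho : D.
Local Notation deg rho := (rdeg (drepr rho)).

Lemma deg_gt0 rho : (0 < deg rho)%N.
Proof. by case/mx_irrP: (rrep_irr (drepr rho)). Qed.

(** Schur's lemma between distinct classes. *)
Lemma intertwiner_eq0 rho rho' (A : 'M[R[i]]_(deg rho, deg rho')) :
  rho != rho' ->
  (forall g, drepr rho g *m A = A *m drepr rho' g) -> A = 0.
Proof.
move=> neq rA; apply/eqP; apply: contraNT neq => nzA.
have [_ irr] := (mx_irrP _).1 (rrep_irr (drepr rho)).
have [_ irr'] := (mx_irrP _).1 (rrep_irr (drepr rho')).
have modK : mxmodule (drepr rho) (kermx A).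
  apply/mxmoduleP => g _; apply/sub_kermxP.
  by rewrite -mulmxA rA mulmxA mulmx_ker mul0mx.
have modI : mxmodule (drepr rho') <<A>>%MS.
  apply/mxmoduleP => g _; rewrite genmxE (eqmxMr _ (genmxE _)) -rA.
  exact: submxMl.
have freeA : row_free A.
  rewrite -kermx_eq0; apply: contraNT nzA => /(irr _ modK) full.
  have [B BK] := row_fullP full.
  by rewrite -[A]mul1mx -BK -mulmxA mulmx_ker mulmx0.
have fullA : row_full A.
  have := irr' _ modI; rewrite /row_full genmxE; apply.
  by rewrite -mxrank_eq0 genmxE mxrank_eq0.
have eqd : deg rho = deg rho' by rewrite -(eqP freeA) (eqP fullA).
apply/eqP; rewrite -(dreprK rho) -(dreprK rho').
by apply/dclass_eq; exists A.
Qed.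

(** Schur's lemma for one class; the scalar is an eigenvalue. *)
Lemma intertwiner_scalar rho (A : 'M[R[i]]_(deg rho)) :
  (forall g, drepr rho g *m A = A *m drepr rho g) ->
  exists a, A = a%:M.
Proof.
move=> rA; have d0 := deg_gt0 rho.
have /closed_rootP[a ra] : size (char_poly A) != 1%N.
  by rewrite size_char_poly eqSS -lt0n.
exists a; apply/eqP; rewrite -subr_eq0.
have cA : centgmx (drepr rho) (A - a%:M).
  apply/centgmxP => g _.
  by rewrite mulmxBl mulmxBr rA scalar_mxC.
apply: contraTT ra => /(mx_Schur (rrep_irr (drepr rho)) cA) uA.
rewrite rootE -horner_evalE -det_map_mx.
have -> : map_mx (horner_eval a) (char_poly_mx A) = a%:M - A.
  apply/matrixP => i j; rewrite !mxE /horner_eval !hornerE.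
  by rewrite hornerMn hornerX.
by rewrite -opprB -scaleN1r detZ mulf_neq0 ?expf_neq0 ?oppr_eq0 ?oner_eq0 //
  -unitfE -unitmxE.
Qed.

(* The average of [delta_mx j k] over [G], up to the factor [#|G|]. *)
Let average rho rho' j k : 'M[R[i]]_(deg rho, deg rho') :=
  \sum_g drepr rho g *m delta_mx j k *m drepr rho' g^-1%g.

Let averageE rho rho' i j k l :
  @average rho rho' j k i l =
  \sum_g drepr rho g i j * drepr rho' g^-1%g k l.
Proof.
rewrite summxE; apply: eq_bigr => g _.
rewrite mxE (bigD1 k) //= big1 => [|m mk].
  rewrite addr0 mxE (bigD1 j) //= big1 => [|m mj].
    by rewrite addr0 mxE !eqxx mulr1.
  by rewrite mxE (negPf mj) mulr0.
rewrite mxE big1 ?mul0r // => n _.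
by rewrite mxE (negPf mk) andbF mulr0.
Qed.

Let average_comm rho rho' j k g :
  drepr rho g *m @average rho rho' j k = average j k *m drepr rho' g.
Proof.
rewrite mulmx_sumr mulmx_suml (reindex_inj (mulgI g^-1%g)) /=.
apply: eq_bigr => h _.
rewrite -[RHS]mulmxA -repr_mxM ?inE // !mulmxA -repr_mxM ?inE // mulKVg.
by rewrite invMg invgK.
Qed.

Lemma schur_orthogonality_neq rho rho' i j k l : rho != rho' ->
  \sum_g drepr rho g i j * drepr rho' g^-1%g k l = 0.
Proof.
move=> neq; rewrite -averageE (@intertwiner_eq0 _ _ (average j k)) ?mxE //.
Qed.

Lemma schur_orthogonality rho i j k l :
  \sum_g drepr rho g i j * drepr rho g^-1%g k l =
  #|G|%:R / (deg rho)%:R * (i == l)%:R * (j == k)%:R.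
Proof.
rewrite -averageE; have [a Ea] := intertwiner_scalar (average_comm j k).
have d0 : (deg rho)%:R != 0 :> R[i] by rewrite pnatr_eq0 -lt0n deg_gt0.
have : \tr (@average rho rho j k) = #|G|%:R * (j == k)%:R.
  rewrite raddf_sum /= (eq_bigr (fun=> (j == k)%:R)) => [|g _].
    by rewrite sumr_const mulr_natl.
  rewrite mxtrace_mulC mulmxA -repr_mxM ?inE // mulVg repr_mx1 mul1mx.
  rewrite /mxtrace (bigD1 j) //= big1 => [|m mj].
    by rewrite addr0 mxE eqxx.
  by rewrite mxE (negPf mj).
rewrite Ea mxtrace_scalar => e; rewrite mxE -(mulr_natr a).
have -> : a = #|G|%:R * (j == k)%:R / (deg rho)%:R.
  by rewrite -e -(mulr_natr a) mulfK.
by rewrite (mulrAC #|G|%:R) [LHS]mulrAC.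
Qed.

(* The difference of the two sides of [sum_characters] below. It vanishes
   because it acts as zero in every irreducible unitary representation, hence in
   the regular one. *)
Let defect (g : G) : R[i] :=
  (g == 1%g)%:R -
  \sum_(rho : D) (deg rho)%:R / #|G|%:R * \tr (drepr rho g^-1%g).

Let defect_dual rho : \sum_g defect g *: drepr rho g = 0.
Proof.
have d0 (r : D) : (deg r)%:R != 0 :> R[i] by rewrite pnatr_eq0 -lt0n deg_gt0.
have G0 : #|G|%:R != 0 :> R[i].
  by rewrite pnatr_eq0 -lt0n; apply/card_gt0P; exists 1%g.
apply/matrixP => i l; rewrite summxE mxE.
under eq_bigr do rewrite mxE mulrBl mulr_suml.
rewrite sumrB (bigD1 1%g) //= eqxx mul1r repr_mx1 mxE big1 => [|g /negPf->].
  rewrite addr0 exchange_big (bigD1 rho) //=.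
  rewrite [X in _ - (_ + X)]big1 => [|rho' neq].
    rewrite addr0; apply/eqP; rewrite subr_eq0; apply/eqP/esym.
    transitivity (\sum_k (deg rho)%:R / #|G|%:R *
      \sum_g (drepr rho g i l * drepr rho g^-1%g k k)).
      under [RHS]eq_bigr do rewrite mulr_sumr.
      rewrite exchange_big /=; apply: eq_bigr => g _.
      by rewrite -!mulr_sumr [LHS]mulrAC -[LHS]mulrA.
    under eq_bigr do rewrite schur_orthogonality.
    rewrite (bigD1 l) //= big1 => [|k /negPf kl].
      by rewrite addr0 eqxx mulr1 mulrA mulrA mulfVK // mulfV // mul1r.
    by rewrite [l == k]eq_sym kl mulr0 mulr0.
  transitivity (\sum_k (deg rho')%:R / #|G|%:R *
      \sum_g (drepr rho g i l * drepr rho' g^-1%g k k)).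
    under [RHS]eq_bigr do rewrite mulr_sumr.
    rewrite exchange_big /=; apply: eq_bigr => g _.
    by rewrite -!mulr_sumr [LHS]mulrAC -[LHS]mulrA.
  apply: big1 => k _; rewrite schur_orthogonality_neq ?mulr0 //.
  by rewrite eq_sym.
by rewrite mul0r.
Qed.

Let defect_irrep (r : unitary_irrep R G) : \sum_g defect g *: r g = 0.
Proof.
have [B dB fB rB] : mx_rsim r (drepr (dclass D r)).
  by apply/(@dclass_eq _ _ D); rewrite dreprK.
apply: (row_free_inj fB); rewrite mul0mx mulmx_suml.
transitivity (B *m \sum_g defect g *: drepr (dclass D r) g).
  rewrite mulmx_sumr; apply: eq_bigr => g _.
  by rewrite -scalemxAl rB ?inE // scalemxAr.
by rewrite defect_dual mulmx0.
Qed.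

Local Notation aG := (regular_repr R[i] [set: G]%G).
Local Notation nG := (gcard [set: G]%G).

Lemma regular_unitary (g : G) : aG g \is unitarymx.
Proof.
apply/row_unitarymxP => i j; rewrite dotmxE !rowK.
have -> : (i == j) =
    (gring_index [set: G]%G (enum_val i * g) ==
     gring_index [set: G]%G (enum_val j * g)).
  rewrite -(inj_eq enum_val_inj) !gring_indexK ?inE //.
  by rewrite (inj_eq (mulIg g)) (inj_eq enum_val_inj).
by rewrite trmx_delta map_delta_mx mul_delta_mx_cond mulmxnE mxE !eqxx.
Qed.

(** A simple submodule of the regular representation is a unitary irreducible
    representation: an orthonormal basis of it gives unitary matrices, because
    the regular representation acts by permutation matrices. *)
Section SimpleSubmodule.
Variable V : 'M[R[i]]_nG.
Hypothesis simV : mxsimple aG V.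

Let m : nat := \rank V.
Let U : 'M[R[i]]_(m, nG) := schmidt (row_base V).

Let U_unitary : U *m U ^t* = 1%:M.
Proof. by apply/unitarymxP/schmidt_unitarymx/rank_leq_col. Qed.

Let eqUV : (U :=: V)%MS.
Proof.
exact: eqmx_trans (eqmx_schmidt_free (row_base_free V)) (eq_row_base V).
Qed.

Let projU n (W : 'M[R[i]]_(n, nG)) : (W <= U)%MS -> W *m U ^t* *m U = W.
Proof.
by case/submxP => X ->; rewrite -mulmxA -mulmxA (mulmxA U) U_unitary mul1mx.
Qed.

Let rU g : 'M[R[i]]_m := U *m aG g *m U ^t*.

Let rUE g : rU g *m U = U *m aG g.
Proof.
apply: projU; rewrite (eqmxMr _ eqUV) eqUV.
by have [modV _ _] := simV; apply: (mxmoduleP modV); rewrite inE.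
Qed.

Let rU_repr : mx_repr [set: G]%G rU.
Proof.
split=> [|g h _ _]; first by rewrite /rU repr_mx1 mulmx1.
by rewrite {1 3}/rU repr_mxM ?inE // !mulmxA rUE.
Qed.

Let repU := MxRepresentation rU_repr.

Let repU_irr : mx_irreducible repU.
Proof.
have [modV nzV irrV] := simV; apply/mx_irrP; split.
  by rewrite lt0n mxrank_eq0.
move=> W modW nzW.
have : (V <= <<W *m U>>)%MS.
  apply: irrV.
  - apply/mxmoduleP => g _; rewrite genmxE (eqmxMr _ (genmxE _)).
    rewrite -mulmxA -rUE mulmxA submxMr //.
    by apply: (mxmoduleP modW); rewrite inE.
  - by rewrite genmxE -eqUV submxMl.
  - rewrite -mxrank_eq0 genmxE mxrank_eq0.
    apply: contraNneq nzW => e.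
    by rewrite -[W]mulmx1 -U_unitary mulmxA e mul0mx.
rewrite genmxE -eqUV => /submxP[X e].
apply/row_fullP; exists X.
by rewrite -[X *m W]mulmx1 -U_unitary !mulmxA -(mulmxA X) -e.
Qed.

Let repU_unitary g : repU g \is unitarymx.
Proof.
apply/unitarymxP; rewrite -[repr_mx repU g]/(U *m aG g *m U ^t*).
have -> : (U *m aG g *m U ^t*) ^t* = U *m (aG g) ^t* *m U ^t*.
  by rewrite !trmx_mul !map_mxM trmxCK mulmxA.
rewrite !mulmxA -/(rU g) rUE -(mulmxA U) (unitarymxP _) ?regular_unitary //.
by rewrite mulmx1.
Qed.

Lemma defect_simple : V *m (\sum_g defect g *: aG g) = 0.
Proof.
have VU : (V <= U)%MS by rewrite eqUV.
have {VU} [X ->] := submxP VU; rewrite -mulmxA.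
rewrite mulmx_sumr (eq_bigr (fun g => (defect g *: rU g) *m U)) => [|g _].
  rewrite -mulmx_suml.
  by rewrite (defect_irrep (UnitaryIrrep repU_irr repU_unitary)) mul0mx mulmx0.
by rewrite -scalemxAr -scalemxAl rUE.
Qed.

End SimpleSubmodule.

(** The decomposition of the delta function at the unit of [G] into
    irreducible characters. *)
Lemma sum_characters (g : G) :
  \sum_(rho : D) (deg rho)%:R / #|G|%:R * \tr (drepr rho g^-1%g) =
  (g == 1%g)%:R.
Proof.
apply/esym/eqP; rewrite -subr_eq0 -/(defect g).
set B := \sum_h defect h *: aG h.
(* By Maschke's theorem, the regular representation is a sum of simple modules. *)
have : B == 0.
  have pG : ([pchar R[i]]^'.-group [set: G]%G)%g.
    apply: sub_in_pnat (pnat_pi (cardG_gt0 [set: G]%G)) => p _ _.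
    by rewrite inE /= pchar_num.
  apply: (mx_reducible_semisimple (mxmodule1 aG) (mx_Maschke_pchar aG pG)).
  case=> I W sumW simW eqW _.
  apply/eqP; rewrite -[B]mul1mx; apply/sub_kermxP.
  rewrite -eqW /sumW; apply/sumsmx_subP => i _; apply/sub_kermxP.
  exact: defect_simple.
move/eqP/matrixP/(_ (gring_index [set: G]%G 1%g) (gring_index [set: G]%G g)).
rewrite summxE mxE (bigD1 g) //= big1 => [|h neq].
  rewrite addr0 !mxE gring_indexK ?inE // mul1g !eqxx mulr1 => ->.
  by rewrite eqxx.
rewrite !mxE gring_indexK ?inE // mul1g eqxx /=.
rewrite (inj_in_eq (can_in_inj (@gring_indexK _ _))) ?inE //.
by rewrite eq_sym (negPf neq) mulr0.
Qed.

End SchurOrthogonality.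

(** * Etale spaces through their local sections *)

Section LocalSections.
Variables (R : realType) (X : topologicalType) (S : bundle R X).
Hypothesis shS : is_sheaf S.

(** [h] is a lift of [b : Z -> X] to the etale space; it is continuous at [z]. *)
Definition continuous_lift (Z : topologicalType) (b : Z -> X)
    (h : forall z, stalk S (b z)) (z : Z) : Prop :=
  {for z, continuous (fun z => germ (h z) : espace S)}.

(** [s] is a section that is continuous at [x]. It is defined on all of [X], but
    only its germ at [x] matters, by [continuous_lift_eq]. *)
Definition section_at (s : forall x, stalk S x) (x : X) : Prop :=
  @continuous_lift X (fun y => y) s x.

Lemma germ_inj x : injective (@germ R X S x).
Proof.
move=> u v /eqP.
by rewrite (@eq_Tagged X (stalk S) (Tagged (stalk S) u)) => /eqP.
Qed.

(** The image of a section that is continuous at [x] is a neighbourhood of its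
    value at [x]. *)
Lemma section_germ s x : section_at s x ->
  \forall e \near (germ (s x) : espace S), germ (s (ebase e)) = e.
Proof.
move=> cs; have [[cb lh] _ _] := shS.
have [U [oU Ux injU _]] := lh (germ (s x)).
have nU : nbhs (germ (s x) : espace S) U by exact: open_nbhs_nbhs.
have nb : nbhs (germ (s x) : espace S)
    (@ebase _ _ S @^-1` [set y | U (germ (s y))]) by apply: cb; exact: cs.
by apply: filterS2 nU nb => e Ue Us; apply: injU; rewrite ?inE.
Qed.

Lemma section_through x (v : stalk S x) :
  exists s, s x = v /\ \forall y \near x, section_at s y.
Proof.
have [[cb lh] _ _] := shS.
have [U [oU Uv injU Uopen]] := lh (germ v).
pose s y : stalk S y := xget 0 [set w | U (germ w)].
have sU y w : U (@germ _ _ S y w) -> s y = w.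
  move=> Uw; apply: germ_inj; apply: injU => //; rewrite inE //.
  by rewrite /s; case: xgetP => [? -> //|/(_ w)].
exists s; split; first exact: sU.
have oN : open (@ebase _ _ S @` U) by apply: Uopen.
have : nbhs x (@ebase _ _ S @` U).
  by apply: open_nbhs_nbhs; split => //; exists (germ v).
apply: filterS => _ [[y w] /= Uw <-] W /=; rewrite /= (sU _ _ Uw) => nW.
have [B [[oB Bw] BW]] : exists B : set (espace S),
    open_nbhs (germ w : espace S) B /\ B `<=` W.
  by move: nW; rewrite nbhsE => -[B]; exists B.
have oI : open (@ebase _ _ S @` (U `&` B)).
  by apply: Uopen; [exact: openI | move=> ? []].
have : nbhs y (@ebase _ _ S @` (U `&` B)).
  by apply: open_nbhs_nbhs; split => //; exists (germ w).
by apply: filterS => _ [[z u] [/= Uu Bu] <-]; apply: BW; rewrite /= (sU _ _ Uu).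
Qed.

Section Lifts.
Variables (Z : topologicalType) (b : Z -> X).
Implicit Types (h : forall z, stalk S (b z)) (z : Z).

Lemma continuous_lift_base h z :
  continuous_lift h z -> {for z, continuous b}.
Proof.
have [[cb _] _ _] := shS.
by move=> ch; exact: (continuous_comp ch (cb _)).
Qed.

Lemma continuous_lift_uniq h h' z :
  continuous_lift h z -> continuous_lift h' z -> h z = h' z ->
  \forall z' \near z, h z' = h' z'.
Proof.
move=> ch ch' e; have [[cb lh] _ _] := shS.
have [U [oU Uz injU _]] := lh (germ (h z)).
have n1 : \forall z' \near z, U (germ (h z')).
  by apply: ch; exact: open_nbhs_nbhs.
have n2 : \forall z' \near z, U (germ (h' z')).
  by apply: ch'; rewrite -e; exact: open_nbhs_nbhs.
apply: filterS2 n1 n2 => z' U1 U2; apply: germ_inj.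
by apply: injU; rewrite ?inE.
Qed.

Lemma continuous_lift_eq h h' z :
  (\forall z' \near z, h z' = h' z') ->
  continuous_lift h z -> continuous_lift h' z.
Proof.
move=> e ch W; rewrite /= -(nbhs_singleton e) => /ch /=.
by apply: filterS2 e => z' /= ->.
Qed.

Lemma continuous_lift_section s z :
  section_at s (b z) -> {for z, continuous b} ->
  continuous_lift (fun z => s (b z)) z.
Proof. by move=> cs cb; exact: (continuous_comp cb cs). Qed.

Lemma continuous_liftP h s z :
  section_at s (b z) -> {for z, continuous b} -> s (b z) = h z ->
  continuous_lift h z <-> \forall z' \near z, s (b z') = h z'.
Proof.
move=> cs cb e; have cl := continuous_lift_section cs cb.
split=> [ch|sh]; first exact: continuous_lift_uniq.
exact: continuous_lift_eq sh cl.
Qed.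

Lemma continuous_liftD h h' z :
  continuous_lift h z -> continuous_lift h' z ->
  continuous_lift (fun z => h z + h' z) z.
Proof.
have [_ ad _] := shS => ch ch'.
pose pr z : epair S :=
  existT (fun x => (stalk S x * stalk S x)%type) (b z) (h z, h' z).
have cpr : {for z, continuous pr}.
  move=> W [B [[A oA <-] Az AW]].
  have cA := open_nbhs_nbhs (conj oA Az).
  have nA : \forall z' \near z, A (epair_incl (pr z')).
    exact: (cvg_pair ch ch' cA).
  by apply: filterS nA => z' /AW.
exact: (continuous_comp cpr (ad _)).
Qed.

Lemma continuous_liftZ a h z :
  continuous_lift h z -> continuous_lift (fun z => a *: h z) z.
Proof. by have [_ _ sc] := shS => ch; exact: (continuous_comp ch (sc a _)). Qed.

Lemma continuous_lift0 z : {for z, continuous b} ->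
  continuous_lift (fun z => 0 : stalk S (b z)) z.
Proof.
move=> cb; have [s [_ /nbhs_singleton cs]] := section_through (0 : stalk S (b z)).
apply: (continuous_lift_eq _
  (continuous_liftZ (a := 0) (continuous_lift_section cs cb))).
by near=> z'; rewrite scale0r.
Unshelve. all: by end_near. Qed.

Lemma continuous_lift_sum (I : Type) (r : seq I)
    (h : I -> forall z, stalk S (b z)) z :
  {for z, continuous b} -> (forall i, continuous_lift (h i) z) ->
  continuous_lift (fun z => \sum_(i <- r) h i z) z.
Proof.
move=> cb ch; elim: r => [|i r IH].
  apply: (continuous_lift_eq _ (continuous_lift0 cb)).
  by near=> z'; rewrite big_nil.
apply: (continuous_lift_eq _ (continuous_liftD (ch i) IH)).
by near=> z'; rewrite big_cons.
Unshelve. all: by end_near. Qed.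

Lemma continuous_lift_near h z :
  continuous b -> continuous_lift h z ->
  \forall z' \near z, continuous_lift h z'.
Proof.
move=> cb ch; have [s [e ns]] := section_through (h z).
have /(continuous_liftP (nbhs_singleton ns) (cb z) e) := ch.
move=> /near_join n1; have n2 : \forall z' \near z, section_at s (b z').
  exact: cb ns.
apply: filterS2 n1 n2 => z' n1 n2.
exact: continuous_lift_eq n1 (continuous_lift_section n2 (cb z')).
Qed.

End Lifts.

(** Continuity of a map on an etale space is tested along sections. *)
Lemma continuous_espaceP (T : topologicalType) (F : espace S -> T) :
  (forall s x, section_at s x -> {for x, continuous (fun y => F (germ (s y)))}) ->
  continuous F.
Proof.
move=> cF [x v] W; have [[cb _] _ _] := shS.
have [s [e /nbhs_singleton cs]] := section_through v.
rewrite -/(germ v) -e => nW.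
have n1 : nbhs (germ (s x) : espace S)
    (@ebase _ _ S @^-1` [set y | W (F (germ (s y)))]).
  by apply: cb; exact: (cF _ _ cs).
by apply: filterS2 (section_germ cs) n1 => d /= ed; rewrite ed.
Qed.

End LocalSections.

Section ActionContinuity.
Variables (R : realType) (X : topologicalType) (K : groupoid X).

Section Pack.
Variable S : bundle R X.

(** The pair of an arrow from [x] to [y] and an element of the stalk at [y], as
    a point of the fibre product of the arrows and the etale space. The element
    is transported to the stalk at the target of the arrow. *)
Definition pack x y (g : ghom K x y) (u : stalk S y) : eact_space K S :=
  existT (fun g : arr K => stalk S (tgt g)) (sval g)
    (let: conj _ e := proj2_sig g in eq_rect y (stalk S) u _ (esym e)).

Lemma eact_incl_pack x y (g : ghom K x y) (u : stalk S y) :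
  eact_incl (pack g u) = (sval g, germ u).
Proof. by case: g => g [/= e1 e2]; subst. Qed.

Lemma pack_continuous (Z : topologicalType) (a b : Z -> X)
    (k : forall z, ghom K (a z) (b z)) (h : forall z, stalk S (b z)) z :
  {for z, continuous (fun z => sval (k z) : arr K)} ->
  continuous_lift h z -> {for z, continuous (fun z => pack (k z) (h z))}.
Proof.
move=> ck ch W [B [[A oA <-] Az AW]].
have : \forall z' \near z, A (eact_incl (pack (k z') (h z'))).
  move: Az; rewrite /= eact_incl_pack => Az.
  have nA : \forall z' \near z, A (sval (k z'), germ (h z')).
    exact: (cvg_pair ck ch (open_nbhs_nbhs (conj oA Az))).
  by apply: filterS nA => z'; rewrite eact_incl_pack.
by apply: filterS => z' /AW.
Qed.

End Pack.

(** Continuity of a groupoid action is tested along sections. *)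
Lemma continuous_actionP (S : bundle R X)
    (act : forall x y, ghom K x y -> stalk S y -> stalk S x) :
  is_sheaf S ->
  (forall s (g : arr K), section_at s (tgt g) ->
    continuous_lift (fun g : arr K => act _ _ (as_hom g) (s (tgt g))) g) ->
  continuous (fun p : eact_space K S =>
    germ (act _ _ (as_hom (projT1 p)) (projT2 p)) : espace S).
Proof.
move=> shS cact [g u] /=.
have [s [e /nbhs_singleton cs]] := section_through shS u.
have cincl := @initial_continuous _ _ (@eact_incl R X K S).
set p0 : eact_space K S := existT _ g u.
have c1 : {for p0, continuous (fun p : eact_space K S => projT1 p)}.
  exact: (continuous_comp (cincl p0) cvg_fst).
have c2 : {for p0, continuous
    (fun p : eact_space K S => germ (projT2 p) : espace S)}.
  exact: (continuous_comp (cincl p0) cvg_snd).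
have n : \forall p \near p0, s (tgt (projT1 p)) = projT2 p.
  have sg := section_germ shS cs; rewrite e in sg.
  have n : \forall p \near p0, germ (s (tgt (projT1 p))) = germ (projT2 p).
    exact: (c2 _ sg).
  by apply: filterS n => p; apply: germ_inj.
have c3 : {for p0, continuous (fun p : eact_space K S =>
   germ (act _ _ (as_hom (projT1 p)) (s (tgt (projT1 p)))) : espace S)}.
  exact: (continuous_comp c1 (cact _ _ cs)).
have {}c3 : {for p0, continuous (fun p : eact_space K S =>
    germ (act _ _ (as_hom (projT1 p)) (projT2 p)) : espace S)}.
  move=> W; rewrite /= -e => /c3 /=.
  by apply: filterS2 n => p /= ->.
exact: c3.
Qed.

Variable c : cochain2 R K.
Variable S : twisted_sheaf c.

Lemma continuous_lift_tact (Z : topologicalType) (a b : Z -> X)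
    (k : forall z, ghom K (a z) (b z)) (h : forall z, stalk S (b z)) z :
  {for z, continuous (fun z => sval (k z) : arr K)} ->
  continuous_lift h z -> continuous_lift (fun z => tact (k z) (h z)) z.
Proof.
move=> ck ch.
have := continuous_comp (pack_continuous ck ch) (@tact_continuous _ _ _ _ S _).
have -> // : (fun p : eact_space K S =>
    germ (tact (as_hom (projT1 p)) (projT2 p)) : espace S) \o
    (fun z => pack (k z) (h z)) = fun z => germ (tact (k z) (h z)).
apply/funext => z' /=; case: (k z') => g [e1 e2]; move: (h z').
by move: e1 e2 => /=; case: _ / => e2; case: _ / e2.
Qed.

Variable S' : twisted_sheaf c.

Lemma tact_sum x y (g : ghom K x y) (I : Type) (r : seq I) (u : I -> stalk S y) :
  tact g (\sum_(i <- r) u i) = \sum_(i <- r) tact g (u i).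
Proof.
elim: r => [|i r IH]; last by rewrite !big_cons tactD IH.
by rewrite !big_nil -[0 in LHS](scale0r (0 : stalk S y)) tactZ scale0r.
Qed.

Section HomLinear.
Variables (f : tsheaf_hom S S') (x : X).

Lemma tmapD (u v : stalk S x) : f x (u + v) = f x u + f x v.
Proof. by rewrite -[u]scale1r tmap_linear !scale1r. Qed.

Lemma tmap0 : f x (0 : stalk S x) = 0.
Proof. by apply: (addrI (f x 0)); rewrite -tmapD !addr0. Qed.

Lemma tmapZ a (u : stalk S x) : f x (a *: u) = a *: f x u.
Proof. by rewrite -[a *: u]addr0 tmap_linear tmap0 addr0. Qed.

Lemma tmap_sum (I : Type) (r : seq I) (u : I -> stalk S x) :
  f x (\sum_(i <- r) u i) = \sum_(i <- r) f x (u i).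
Proof.
elim: r => [|i r IH]; first by rewrite !big_nil tmap0.
by rewrite !big_cons tmapD IH.
Qed.

End HomLinear.

Lemma tmap_lift (f : tsheaf_hom S S') (Z : topologicalType) (b : Z -> X)
    (h : forall z, stalk S (b z)) z :
  continuous_lift h z -> continuous_lift (fun z => f _ (h z)) z.
Proof.
move=> ch; exact: (continuous_comp ch (@tmap_continuous _ _ _ _ _ _ f _)).
Qed.

(** A morphism of etale spaces is a local homeomorphism, so a bijective one has
    a continuous inverse. *)
Lemma bijective_is_iso (f : tsheaf_hom S S') :
  (forall x, bijective (@tmap _ _ _ _ _ _ f x)) ->
  exists g : tsheaf_hom S' S,
    (forall x u, g x (f x u) = u) /\ (forall x u, f x (g x u) = u).
Proof.
move=> bf.
have /all_sig2[g fK gK] x : {g : stalk S' x -> stalk S x |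
    cancel (@tmap _ _ _ _ _ _ f x) g & cancel g (@tmap _ _ _ _ _ _ f x)}.
  by apply: cid2; have [g] := bf x; exists g.
have lg x a u v : g x (a *: u + v) = a *: g x u + g x v.
  by apply: (can_inj (fK x)); rewrite tmap_linear !gK.
have ag x y (k : ghom K x y) u : g x (tact k u) = tact k (g y u).
  by apply: (can_inj (fK x)); rewrite tmap_act !gK.
have shS := tsheafP S; have shS' := tsheafP S'.
have cg : continuous (fun e : espace S' => germ (g _ (projT2 e)) : espace S).
  apply: continuous_espaceP => //= s x cs.
  have [t [e /nbhs_singleton ct]] := section_through shS (g x (s x)).
  have ft := tmap_lift (f := f) ct.
  have n : \forall y \near x, f y (t y) = s y.
    by apply: (continuous_lift_uniq shS' ft cs); rewrite /= e gK.
  apply: continuous_lift_eq ct; apply: filterS n => y <-.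
  by rewrite fK.
by exists (TSheafHom lg ag cg).
Qed.

End ActionContinuity.

(** ** The sheaf defined by a class of germs of sections *)

Section SectionTopology.
Variables (R : realType) (X : topologicalType) (V : X -> lmodType R[i]).
Variable P : (forall x, V x) -> X -> Prop.

(** [P s x] reads: the section [s] is admissible at [x]. It depends only on the
    germ of [s] at [x]. *)
Record section_system : Prop := SectionSystem {
  system_through : forall x (v : V x), exists s, P s x /\ s x = v;
  system_near : forall s x, P s x -> \forall y \near x, P s y;
  system_uniq : forall s t x, P s x -> P t x -> s x = t x ->
    \forall y \near x, s y = t y;
  system_eq : forall s t x, (\forall y \near x, s y = t y) -> P s x -> P t x;
  systemD : forall s t x, P s x -> P t x -> P (fun y => s y + t y) x;
  systemZ : forall a s x, P s x -> P (fun y => a *: s y) x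
}.

(** The finest topology for which the admissible sections are continuous. *)
Definition section_open (W : set {x & V x}) : Prop :=
  forall s x, P s x -> W (existT _ x (s x)) ->
    \forall y \near x, W (existT _ y (s y)).

Lemma section_openT : section_open setT.
Proof. by move=> s x _ _; exact: filterT. Qed.

Lemma section_openI : setI_closed section_open.
Proof.
move=> A B oA oB s x Ps [As Bs].
by apply: filterS2 (oA _ _ Ps As) (oB _ _ Ps Bs).
Qed.

Lemma section_open_bigU (I : Type) (f : I -> set {x & V x}) :
  (forall i, section_open (f i)) -> section_open (\bigcup_i f i).
Proof.
move=> of_ s x Ps [i _ fi].
by apply: filterS (of_ i _ _ Ps fi) => y fy; exists i.
Qed.

Definition section_bundle : bundle R X :=
  Bundle section_openT section_openI section_open_bigU.

Lemma open_sectionP (W : set (espace section_bundle)) : open W <-> section_open W.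
Proof. by split=> [oW|oW]; exact: oW. Qed.

Lemma system_section s x : P s x -> section_at (S := section_bundle) s x.
Proof.
move=> Ps W [B [oB Bs BW]].
by apply: filterS (oB _ _ Ps Bs) => y /BW.
Qed.

Hypothesis sysP : section_system.

(* The image of the restriction of [s] to [N]. *)
Let section_graph (s : forall x, V x) (N : set X) : set (espace section_bundle) :=
  [set e | N (ebase e) /\ e = germ (S := section_bundle) (s (ebase e))].

Let section_graph_open s N :
  open N -> (forall y, N y -> P s y) -> open (section_graph s N).
Proof.
move=> oN NP; apply/open_sectionP => t x Pt [/= Nx].
move/eqP; rewrite (@eq_Tagged X V (Tagged V (t x))) /= => /eqP e.
have nN : nbhs x N by exact: open_nbhs_nbhs.
apply: filterS2 nN (system_uniq sysP Pt (NP _ Nx) e) => y Ny /= ey.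
by split => //=; rewrite ey.
Qed.

Let system_open s x :
  P s x -> exists N : set X, [/\ open N, N x & forall y, N y -> P s y].
Proof.
move=> Ps; have : nbhs x (P s) := system_near sysP Ps.
by rewrite nbhsE => -[N [oN Nx] NP]; exists N.
Qed.

Lemma section_bundle_sheaf : is_sheaf section_bundle.
Proof.
have base_cont : continuous (@ebase R X section_bundle).
  apply/continuousP => A oA; apply/open_sectionP => s x Ps Ax.
  by apply: filterS (open_nbhs_nbhs (conj oA Ax)).
split.
- split=> // -[x v]; have [s [Ps e]] := system_through sysP v.
  have [N [oN Nx NP]] := system_open Ps.
  exists (section_graph s N); split.
  + exact: section_graph_open.
  + by split => //=; rewrite e.
  + move=> d d'; rewrite !inE => -[_ ->] [_ ->] /= -> //.
  + move=> W oW WN; rewrite openE => _ [d Wd <-].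
    have [Nd ed] := WN _ Wd; rewrite ed in Wd.
    have := (open_sectionP _).1 oW _ _ (NP _ Nd) Wd.
    by apply: filterS => y Wy; exists (germ (S := section_bundle) (s y)).
- move=> -[x [v w]] W /= [B [oB Bvw BW]].
  have [s [Ps es]] := system_through sysP v.
  have [t [Pt et]] := system_through sysP w.
  have [Ns [oNs Nsx NsP]] := system_open Ps.
  have [Nt [oNt Ntx NtP]] := system_open Pt.
  have : nbhs x [set y | B (germ (S := section_bundle) (s y + t y))].
    by apply: ((open_sectionP _).1 oB _ _ (systemD sysP Ps Pt)); rewrite es et.
  rewrite nbhsE => -[N [oN Nx] NB].
  exists ([set p | section_graph s (N `&` Ns) (epair_incl p).1 /\
              section_graph t Nt (epair_incl p).2]); split.
  + exists (section_graph s (N `&` Ns) `*` section_graph t Nt) => //.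
    rewrite -[X in open X]/((fst @^-1` section_graph s (N `&` Ns)) `&`
      (snd @^-1` section_graph t Nt)); apply: openI.
      apply: open_comp; first by move=> ? _; exact: cvg_fst.
      by apply: section_graph_open => [|y [_ /NsP]]; first exact: openI.
    apply: open_comp; first by move=> ? _; exact: cvg_snd.
    exact: section_graph_open.
  + by split; split => //=; rewrite ?es ?et.
  + move=> [y [v' w']] [[/= [Ny _] ev] [/= _ ew]]; apply: BW.
    rewrite /eadd /= (germ_inj ev) (germ_inj ew).
    exact: NB.
- move=> a; apply/continuousP => B oB; apply/open_sectionP => s x Ps /= Bs.
  exact: (open_sectionP _).1 oB _ _ (systemZ sysP a Ps) Bs.
Qed.

(** No other section is continuous. *)
Lemma section_bundleP s x : section_at (S := section_bundle) s x <-> P s x.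
Proof.
split=> [cs|]; last exact: system_section.
have [t [Pt e]] := system_through sysP (s x).
apply: (system_eq sysP _ Pt).
exact: (continuous_lift_uniq section_bundle_sheaf (system_section Pt) cs e).
Qed.

End SectionTopology.

(** * Matrices acting on tuples of vectors *)

Section MatrixAction.
Variables (C : comNzRingType) (V : lmodType C).

(** The product of the matrix [A] with the column [phi] of vectors of [V]. *)
Definition mxact m n (A : 'M[C]_(m, n)) (phi : 'I_n -> V) (i : 'I_m) : V :=
  \sum_j A i j *: phi j.

Lemma mxactM m n p (A : 'M[C]_(m, n)) (B : 'M[C]_(n, p)) phi i :
  mxact (A *m B) phi i = mxact A (mxact B phi) i.
Proof.
rewrite /mxact; under eq_bigr do rewrite mxE scaler_suml.
rewrite exchange_big /=; apply: eq_bigr => j _.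
by rewrite scaler_sumr; apply: eq_bigr => k _; rewrite scalerA.
Qed.

Lemma mxact1 n (phi : 'I_n -> V) i : mxact 1%:M phi i = phi i.
Proof.
rewrite /mxact (bigD1 i) //= big1 => [|j /negPf ji].
  by rewrite addr0 mxE eqxx scale1r.
by rewrite mxE eq_sym ji scale0r.
Qed.

Lemma mxactZ m n a (A : 'M[C]_(m, n)) phi i :
  mxact (a *: A) phi i = a *: mxact A phi i.
Proof.
by rewrite scaler_sumr; apply: eq_bigr => j _; rewrite mxE scalerA.
Qed.

Lemma mxact_scale m n a (A : 'M[C]_(m, n)) phi i :
  mxact A (fun j => a *: phi j) i = a *: mxact A phi i.
Proof.
by rewrite scaler_sumr; apply: eq_bigr => j _; rewrite !scalerA mulrC.
Qed.

Lemma eq_mxact m n (A : 'M[C]_(m, n)) phi psi :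
  (forall i, phi i = psi i) -> forall i, mxact A phi i = mxact A psi i.
Proof. by move=> e i; apply: eq_bigr => j _; rewrite e. Qed.

Lemma mxact_linear m n (A : 'M[C]_(m, n)) a phi psi i :
  mxact A (fun j => a *: phi j + psi j) i = a *: mxact A phi i + mxact A psi i.
Proof.
rewrite scaler_sumr -big_split /=; apply: eq_bigr => j _.
by rewrite scalerDr !scalerA mulrC.
Qed.

End MatrixAction.

Section TwistedSheafTheory.
Variables (R : realType) (X : topologicalType) (K : groupoid X).
Variables (c : cochain2 R K) (S S' : twisted_sheaf c).

Lemma tact_mxact x y (g : ghom K x y) m n (A : 'M[R[i]]_(m, n))
    (phi : 'I_n -> stalk S y) i :
  tact g (mxact A phi i) = mxact A (fun j => tact g (phi j)) i.
Proof. by rewrite tact_sum; apply: eq_bigr => j _; rewrite tactZ. Qed.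

Lemma tmap_mxact (f : tsheaf_hom S S') x m n (A : 'M[R[i]]_(m, n))
    (phi : 'I_n -> stalk S x) i :
  f x (mxact A phi i) = mxact A (fun j => f x (phi j)) i.
Proof. by rewrite tmap_sum; apply: eq_bigr => j _; rewrite tmapZ. Qed.

End TwistedSheafTheory.

Lemma tactM (R : realType) (X : topologicalType) (K : groupoid X)
    (S : twisted_sheaf (@trivial_cocycle R X K)) x y z
    (g : ghom K x y) (h : ghom K y z) (u : stalk S z) :
  tact g (tact h u) = tact (gcomp g h) u.
Proof. by rewrite tact_comp scale1r. Qed.

(** * Products with a discrete space *)

Section DiscreteProduct.
Variables (I : choiceType) (Z : topologicalType).
Local Notation IZ := (discrete_topology I * Z)%type.

Lemma near_slice (i : discrete_topology I) (z : Z) (Q : IZ -> Prop) :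
  (\forall y \near z, Q (i, y)) -> \forall a \near ((i, z) : IZ), Q a.
Proof.
move=> nQ; exists ([set i], [set y | Q (i, y)]) => /=.
  by split=> //; rewrite nbhs_principalE; exact: principal_filterP.
by move=> [j y] /= [-> ].
Qed.

Lemma near_sliceP (i : discrete_topology I) (z : Z) (Q : IZ -> Prop) :
  (\forall a \near ((i, z) : IZ), Q a) -> \forall y \near z, Q (i, y).
Proof.
case=> -[A B] /= [nA nB] AB; apply: filterS nB => y By.
by apply: (AB (i, y)); split => //=; exact: nbhs_singleton nA.
Qed.

Lemma continuous_slice (T : topologicalType) (F : IZ -> T)
    (i : discrete_topology I) z :
  {for z, continuous (fun y => F (i, y))} -> {for (i, z), continuous F}.
Proof.
by move=> cF W nW; exact: (near_slice (Q := fun a => W (F a)) (cF W nW)).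
Qed.

Lemma slice_continuous (T : topologicalType) (F : T -> Z)
    (i : discrete_topology I) t :
  {for t, continuous F} -> {for t, continuous (fun t => (i, F t) : IZ)}.
Proof. by move=> cF W nW; exact: (cF _ (near_sliceP (Q := W) nW)). Qed.

(** Extension by zero of a family over the slice [{i} * Z]. *)
Definition extend_slice (V : IZ -> zmodType) (i : discrete_topology I)
    (f : forall y, V (i, y)) (a : IZ) : V a :=
  let: (j, y) as a' := a return V a' in
  if pselect (i = j) is left e
  then eq_rect i (fun j => V (j, y)) (f y) j e else 0.

Lemma extend_sliceE (V : IZ -> zmodType) (i : discrete_topology I)
    (f : forall y, V (i, y)) y : extend_slice f (i, y) = f y.
Proof.
rewrite /extend_slice; case: pselect => // e.
by rewrite (Prop_irrelevance e erefl).
Qed.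

End DiscreteProduct.

Lemma near_forall (Z : topologicalType) (z : Z) (I : finType)
    (P : I -> Z -> Prop) :
  (forall i, \forall y \near z, P i y) -> \forall y \near z, forall i, P i y.
Proof. exact: filter_forall. Qed.

(** * The arrows of the two groupoids *)

Lemma local_diffeo_continuous (R : realType) (X Y : topologicalType)
    (V W : normedModType R) (A : set (chart X V)) (B : set (chart Y W))
    (f : X -> Y) : local_diffeo A B f -> continuous f.
Proof.
by move=> lf x; have [U [g [[_ Ux] _ _ [cU _] _]]] := lf x; exact: cU.
Qed.

Section Continuity.
Variables (R : realType) (G : finGroupType) (Y : gerbe_presentation R G).
Variable s : gerbe_section Y.
Local Notation M := (gM Y).
Local Notation H := (gH Y).
Local Notation Q := (gQ Y).

Lemma srcH_continuous : continuous (@src M H).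
Proof. by have [_ [ls _] _ _ _] := gH_lie Y; exact: local_diffeo_continuous ls. Qed.

Lemma tgtH_continuous : continuous (@tgt M H).
Proof. by have [_ [_ lt] _ _ _] := gH_lie Y; exact: local_diffeo_continuous lt. Qed.

Lemma srcQ_continuous : continuous (@src M Q).
Proof. by have [_ [ls _] _ _ _] := gQ_lie Y; exact: local_diffeo_continuous ls. Qed.

Lemma tgtQ_continuous : continuous (@tgt M Q).
Proof. by have [_ [_ lt] _ _ _] := gQ_lie Y; exact: local_diffeo_continuous lt. Qed.

Lemma gi_continuous g : continuous (fun x : M => sval (gi x g) : arr H).
Proof. by have [cg _] := gi_smooth Y g => x; exact: cg. Qed.

Lemma gsec_continuous :
  continuous (fun q : arr Q => sval (s _ _ (as_hom q)) : arr H).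
Proof. by have [cs _] := gsec_smooth s => x; exact: cs. Qed.

Lemma gj_continuous :
  continuous (fun h : arr H => sval (gj (as_hom h)) : arr Q).
Proof. by have [cj _] := gj_smooth Y => x; exact: cj. Qed.

(** The component in [G] of an arrow [h] of [H], with
    [h = fibre_elt h . sigma(j(h))]. *)
Definition fibre_elt x y (h : ghom H x y) : G :=
  ker_elt (gcomp h (ginv (s _ _ (gj h)))).

Lemma fibre_eltE x y (h : ghom H x y) :
  gcomp (gi x (fibre_elt h)) (s _ _ (gj h)) = h.
Proof.
rewrite ker_eltK; first by rewrite -gcompA gcompVg gcompg1.
by rewrite gj_comp gj_inv gsecK gcompgV.
Qed.

Lemma fibre_elt_uniq x y (h : ghom H x y) g :
  h = gcomp (gi x g) (s _ _ (gj h)) -> fibre_elt h = g.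
Proof.
move=> e; apply: (@gi_inj _ _ Y x).
apply: (@gcompIr _ _ Y _ _ _ (s _ _ (gj h))).
by rewrite /= fibre_eltE.
Qed.

Lemma comp_arrE x y z (f : ghom H x y) (g : ghom H y z)
    (e : composable (sval f, sval g)) :
  comp_arr e = sval (gcomp f g).
Proof.
case: f g e => [f [f1 f2]] [g [g1 g2]] e; subst x y z.
by rewrite /comp_arr /=; congr (sval (gcomp _ _)); exact: homset_inj.
Qed.

Lemma gcomp_continuous (Z : topologicalType) (a b d : Z -> M)
    (f : forall z, ghom H (a z) (b z)) (g : forall z, ghom H (b z) (d z)) z :
  {for z, continuous (fun z => sval (f z) : arr H)} ->
  {for z, continuous (fun z => sval (g z) : arr H)} ->
  {for z, continuous (fun z => sval (gcomp (f z) (g z)) : arr H)}.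
Proof.
move=> cf cg; have [_ _ _ sm _] := gH_lie Y.
have comp z' : composable (sval (f z'), sval (g z')).
  by rewrite /composable /=; case: (svalP (f z')) => _ ->; case: (svalP (g z')).
have [U [F [oU Uz [cF _] FE]]] := sm _ (comp z).
have cfg : {for z, continuous
    (fun z => (sval (f z), sval (g z)) : arr H * arr H)}.
  exact: (cvg_pair cf cg).
have cFz := continuous_comp cfg (cF _ Uz).
have nU : \forall z' \near z, U (sval (f z'), sval (g z')).
  exact: (cfg _ (open_nbhs_nbhs (conj oU Uz))).
have FE' z' : U (sval (f z'), sval (g z')) ->
    F (sval (f z'), sval (g z')) = sval (gcomp (f z') (g z')).
  by move=> Uz'; rewrite (FE _ (comp z') Uz') comp_arrE.
move=> W; rewrite -(FE' _ Uz) => /cFz nW.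
by apply: filterS2 nU nW => z' /= Uz'; rewrite FE'.
Qed.

(** With [g0] the component in [G] of [h0], the map [h |-> g0 sigma(j(h))] is
    continuous, fixes [h0] and preserves sources. As the source map is locally
    injective, this map is the identity near [h0]. *)
Lemma fibre_elt_locally_constant (h0 : arr H) :
  \forall h \near h0, fibre_elt (as_hom h) = fibre_elt (as_hom h0).
Proof.
set g0 := fibre_elt (as_hom h0).
have [_ [ls _] _ _ _] := gH_lie Y.
have [U [k [[oU Uh] _ kK _ _]]] := ls h0.
pose m (h : arr H) := gcomp (gi (src h) g0) (s _ _ (gj (as_hom h))).
have cs : {for h0, continuous (fun h => sval (s _ _ (gj (as_hom h))) : arr H)}.
  have -> : (fun h => sval (s _ _ (gj (as_hom h))) : arr H) =
     (fun q : arr Q => sval (s _ _ (as_hom q)) : arr H) \o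
     (fun h => sval (gj (as_hom h))).
    apply/funext => h /=; case: (gj (as_hom h)) => q [/= e1 e2].
    by move: e1 e2; case: _ /; case: _ /.
  exact: (continuous_comp (@gj_continuous h0) (@gsec_continuous _)).
have cgi : {for h0, continuous (fun h : arr H => sval (gi (src h) g0) : arr H)}.
  exact: (continuous_comp (@srcH_continuous h0) (@gi_continuous g0 _)).
have cm := gcomp_continuous cgi cs.
have m0 : sval (m h0) = h0 by rewrite /m fibre_eltE.
have nU : \forall h \near h0, U h by exact: open_nbhs_nbhs.
have nm : \forall h \near h0, U (sval (m h)).
  by apply: cm; rewrite -/(m h0) m0.
apply: filterS2 nU nm => h Uh' Um; apply: fibre_elt_uniq.
apply: homset_inj; rewrite -/(m h) /=.
rewrite -[LHS](kK _ Uh') -[RHS](kK _ Um); congr k.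
by case: (svalP (m h)).
Qed.

End Continuity.

(** * The intertwiners *)

Section Intertwiners.
Variables (R : realType) (G : finGroupType) (Y : gerbe_presentation R G).
Variables (s : gerbe_section Y) (D : unitary_dual R G) (T : intertwiners s D).
Local Notation M := (gM Y).
Local Notation H := (gH Y).
Local Notation Q := (gQ Y).
Local Notation deg rho := (rdeg (drepr (rho : D))).

Lemma itw_eq (rho rho' : D) (x y : M) (q q' : ghom Q x y)
    (e : dact s q rho = rho') (e' : dact s q' rho = rho') :
  q = q' -> T _ _ _ _ _ e = T _ _ _ _ _ e'.
Proof.
by move=> qq'; subst q'; congr (T _ _ _ _ _ _); exact: Prop_irrelevance.
Qed.

Lemma itw_unit (rho : D) (x : M) (q : ghom Q x x) (e : dact s q rho = rho) :
  q = gid Q x -> T _ _ _ _ _ e = 1%:M.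
Proof. by move=> qq'; subst q; exact: itw_id. Qed.

Lemma itwV (rho rho' : D) (x y : M) (q : ghom Q x y) (e : dact s q rho = rho') :
  (T _ _ _ _ _ e) ^t* *m T _ _ _ _ _ e = 1%:M.
Proof. by have [_ /unitarymxP] := itw_unitary T e; rewrite trmxCK. Qed.

Lemma itwK (rho rho' : D) (x y : M) (q : ghom Q x y) (e : dact s q rho = rho') :
  T _ _ _ _ _ e *m (T _ _ _ _ _ e) ^t* = 1%:M.
Proof. by have [/unitarymxP] := itw_unitary T e. Qed.

Lemma itw_swap (rho rho' : D) (x y : M) (q : ghom Q x y)
    (e : dact s q rho = rho') g :
  T _ _ _ _ _ e *m drepr rho (Ad s q g) = drepr rho' g *m T _ _ _ _ _ e.
Proof. by rewrite (itwE T e) !mulmxA itwK mul1mx. Qed.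

Lemma itwV_swap (rho rho' : D) (x y : M) (q : ghom Q x y)
    (e : dact s q rho = rho') g :
  drepr rho (Ad s q g) *m (T _ _ _ _ _ e) ^t* =
  (T _ _ _ _ _ e) ^t* *m drepr rho' g.
Proof. by rewrite (itwE T e) -!mulmxA itwK mulmx1. Qed.

Lemma reprV_mul (rho : D) g : invmx (drepr rho g) *m drepr rho g = 1%:M.
Proof. by rewrite mulVmx // repr_mx_unit ?inE. Qed.

Lemma repr_mulV (rho : D) g : drepr rho g *m invmx (drepr rho g) = 1%:M.
Proof. by rewrite mulmxV // repr_mx_unit ?inE. Qed.

End Intertwiners.

(** * Sheaves of multiplicity spaces *)

Section MultiplicitySpace.
Variables (R : realType) (G : finGroupType) (Y : gerbe_presentation R G).
Variables (D : unitary_dual R G).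
Local Notation M := (gM Y).
Local Notation H := (gH Y).
Local Notation DM := (discrete_topology D * M)%type.
Local Notation deg rho := (rdeg (drepr (rho : D))).
Variable S : twisted_sheaf (@trivial_cocycle R M H).

(** [phi i] is the image of the [i]-th basis vector of [V_rho] by a linear map
    [V_rho -> S_x], where [a = ([rho], x)]. Representations act on columns,
    whence the transpose. *)
Definition equivariant (a : DM) (phi : 'I_(deg a.1) -> stalk S a.2) : Prop :=
  forall g i, tact (gi a.2 g) (phi i) = mxact (drepr (a.1 : D) g)^T phi i.

(** [Hom_G(V_rho, S_x)], for [a = ([rho], x)]. *)
Record mult_space (a : DM) := MultSpace {
  mult_fun :> 'I_(deg a.1) -> stalk S a.2;
  mult_equivariant : equivariant mult_fun
}.

Section Lmodule.
Variable a : DM.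
Implicit Types phi psi : mult_space a.

Lemma mult_space_eq phi psi : (forall i, phi i = psi i) -> phi = psi.
Proof.
case: phi psi => [f Ef] [g Eg] /= fg.
have E : f = g by apply/funext.
by subst g; congr MultSpace; exact: Prop_irrelevance.
Qed.

Lemma equivariant_linear b (f g : 'I_(deg a.1) -> stalk S a.2) :
  equivariant f -> equivariant g -> equivariant (fun i => b *: f i + g i).
Proof. by move=> Ef Eg k i; rewrite tact_linear Ef Eg mxact_linear. Qed.

Lemma equivariant0 : equivariant (fun _ : 'I_(deg a.1) => 0 : stalk S a.2).
Proof.
move=> k i; rewrite -[0 in LHS](scale0r (0 : stalk S a.2)) tactZ scale0r.
by rewrite /mxact big1 // => j _; rewrite scaler0.
Qed.

Definition mult_zero := MultSpace equivariant0.
Definition mult_lin b phi psi :=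
  MultSpace (equivariant_linear b
    (@mult_equivariant _ phi) (@mult_equivariant _ psi)).
Definition mult_add phi psi := mult_lin 1 phi psi.
Definition mult_scale b phi := mult_lin b phi mult_zero.
Definition mult_opp phi := mult_scale (-1) phi.

Lemma mult_addA : associative mult_add.
Proof. by move=> f g h; apply: mult_space_eq => i /=; rewrite !scale1r addrA. Qed.
Lemma mult_addC : commutative mult_add.
Proof. by move=> f g; apply: mult_space_eq => i /=; rewrite !scale1r addrC. Qed.
Lemma mult_add0 : left_id mult_zero mult_add.
Proof. by move=> f; apply: mult_space_eq => i /=; rewrite scale1r add0r. Qed.
Lemma mult_addN : left_inverse mult_zero mult_opp mult_add.
Proof.
by move=> f; apply: mult_space_eq => i /=; rewrite scale1r addr0 scaleN1r addNr.
Qed.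

HB.instance Definition _ := gen_eqMixin (mult_space a).
HB.instance Definition _ := gen_choiceMixin (mult_space a).
HB.instance Definition _ := GRing.isZmodule.Build (mult_space a)
  mult_addA mult_addC mult_add0 mult_addN.

Lemma mult_scaleA b b' phi :
  mult_scale b (mult_scale b' phi) = mult_scale (b * b') phi.
Proof. by apply: mult_space_eq => i /=; rewrite !addr0 scalerA. Qed.
Lemma mult_scale1 : left_id 1 mult_scale.
Proof. by move=> f; apply: mult_space_eq => i /=; rewrite addr0 scale1r. Qed.
Lemma mult_scaleDr : right_distributive mult_scale +%R.
Proof.
by move=> b f g; apply: mult_space_eq => i /=; rewrite !scale1r !addr0 scalerDr.
Qed.
Lemma mult_scaleDl phi : {morph mult_scale^~ phi : b b' / b + b'}.
Proof.
by move=> b b'; apply: mult_space_eq => i /=; rewrite !scale1r !addr0 scalerDl.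
Qed.

HB.instance Definition _ := GRing.Zmodule_isLmodule.Build R[i] (mult_space a)
  mult_scaleA mult_scale1 mult_scaleDr mult_scaleDl.

Lemma mult_spaceD phi psi i : (phi + psi) i = phi i + psi i.
Proof. by rewrite [LHS]/= scale1r. Qed.
Lemma mult_spaceZ b phi i : (b *: phi) i = b *: phi i.
Proof. by rewrite [LHS]/= addr0. Qed.
Lemma mult_space_mxact m n (A : 'M[R[i]]_(m, n)) 
    (phi : 'I_n -> mult_space a) i k :
  mxact A phi i k = mxact A (fun j => phi j k) i.
Proof.
rewrite /mxact; elim: (index_enum _) => [|j r IH]; first by rewrite !big_nil.
by rewrite !big_cons mult_spaceD mult_spaceZ IH.
Qed.
End Lmodule.

(** A section is admissible when its coordinates are continuous. *)
Definition mult_section (t : forall a, mult_space a) (a : DM) : Prop :=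
  forall i : 'I_(deg a.1), section_at (fun y => t (a.1, y) i : stalk S y) a.2.

Let shS := tsheafP S.

Lemma mult_system : section_system mult_section.
Proof.
have idc (x : M) : {for x, continuous (fun y : M => y)} by exact: cvg_id.
split.
- case=> rho x phi.
  have /all_sig[t tP] i := cid (section_through shS (phi i)).
  have tE i := (tP i).1; have tc i := (tP i).2.
  pose f y : mult_space (rho, y) :=
    if pselect (equivariant (a := (rho, y)) (fun i => t i y)) is left e
    then MultSpace e else 0.
  (* both sides of the equivariance condition are continuous sections of [S], and
     they agree at [x] *)
  have Ef : \forall y \near x, equivariant (a := (rho, y)) (fun i => t i y).
    apply: near_forall => g /=; apply: near_forall => i /=.
    have ct j := nbhs_singleton (tc j).
    apply: (continuous_lift_uniq shS).
    + by apply: continuous_lift_tact; [exact: gi_continuous | exact: ct].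
    + apply: (continuous_lift_sum shS) => // j.
      exact: (continuous_liftZ shS (a := (drepr (rho : D) g)^T i j) (ct j)).
    + rewrite /= tE (mult_equivariant (a := (rho, x))).
      by apply: eq_mxact => j; rewrite tE.
  have fE : \forall y \near x, forall i, f y i = t i y.
    apply: filterS Ef => y Ey i; rewrite /f.
    by case: pselect.
  exists (extend_slice (V := fun a => mult_space a) f); split.
    move=> i; apply: continuous_lift_eq (nbhs_singleton (tc i)).
    by apply: filterS fE => y e; rewrite extend_sliceE e.
  apply: mult_space_eq => i; rewrite extend_sliceE (nbhs_singleton fE).
  exact: tE.
- move=> t [rho x] Pt; apply: near_slice; rewrite /mult_section /=.
  apply: near_forall => i /=.
  apply: (continuous_lift_near shS) (Pt i) => y; exact: idc.
- move=> t t' [rho x] Pt Pt' e; apply: near_slice.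
  have : \forall y \near x, forall i : 'I_(deg rho), t (rho, y) i = t' (rho, y) i.
    apply: near_forall => i; apply: (continuous_lift_uniq shS (Pt i) (Pt' i)).
    by rewrite e.
  by apply: filterS => y ey; apply: mult_space_eq => i; exact: ey.
- move=> t t' [rho x] /near_sliceP e Pt i.
  by apply: continuous_lift_eq (Pt i); apply: filterS e => y ->.
- move=> t t' [rho x] Pt Pt' i.
  apply: (continuous_lift_eq _ (continuous_liftD shS (Pt i) (Pt' i))).
  by apply: nearW => y; rewrite mult_spaceD.
- move=> b t [rho x] Pt i.
  apply: (continuous_lift_eq _ (continuous_liftZ shS (a := b) (Pt i))).
  by apply: nearW => y; rewrite mult_spaceZ.
Qed.

Definition mult_bundle : bundle R DM := section_bundle mult_section.

Lemma mult_bundle_sheaf : is_sheaf mult_bundle.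
Proof. exact: section_bundle_sheaf mult_system. Qed.

Lemma mult_bundleP (t : forall a, mult_space a) a :
  section_at (S := mult_bundle) t a <-> mult_section t a.
Proof. exact: section_bundleP mult_system _ _. Qed.

(** A lift of [z |-> ([rho], b z)] is continuous as soon as its coordinates are. *)
Lemma mult_lift (Z : topologicalType) (rho : D) (b : Z -> M)
    (h : forall z, mult_space (rho, b z)) z :
  {for z, continuous b} ->
  (forall i : 'I_(deg rho),
    continuous_lift (fun z => h z i : stalk S (b z)) z) ->
  continuous_lift (S := mult_bundle) (b := fun z => (rho, b z) : DM) h z.
Proof.
move=> cb ch; have [t [Pt e]] := system_through mult_system (h z).
apply: (continuous_lift_eq _ (continuous_lift_section (S := mult_bundle)
   ((mult_bundleP t (rho, b z)).2 Pt) _)); last exact: slice_continuous.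
have : \forall z' \near z, forall i : 'I_(deg rho), t (rho, b z') i = h z' i.
  apply: near_forall => i; apply: (continuous_lift_uniq shS) (ch i) _.
    exact: (continuous_lift_section (Pt i) cb).
  by rewrite e.
by apply: filterS => z' ey; apply: mult_space_eq => i; exact: ey.
Qed.

Lemma mult_lift_component (Z : topologicalType) (rho : D) (b : Z -> M)
    (h : forall z, mult_space (rho, b z)) z (i : 'I_(deg rho)) :
  continuous_lift (S := mult_bundle) (b := fun z => (rho, b z) : DM) h z ->
  continuous_lift (fun z => h z i : stalk S (b z)) z.
Proof.
move=> ch; have [t [Pt e]] := system_through mult_system (h z).
have cb : {for z, continuous b}.
  have cb' := continuous_lift_base mult_bundle_sheaf ch.
  exact: (continuous_comp cb' cvg_snd).
apply: (continuous_lift_eq _ (continuous_lift_section (Pt i) cb)).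
have ct := continuous_lift_section ((mult_bundleP t (rho, b z)).2 Pt)
  (slice_continuous (i := rho) cb).
by apply: filterS (continuous_lift_uniq mult_bundle_sheaf ct ch e) => z' ->.
Qed.

End MultiplicitySpace.

(** * The functor of multiplicity spaces *)

Section MultiplicityFunctor.
Variables (R : realType) (G : finGroupType) (Y : gerbe_presentation R G).
Variables (s : gerbe_section Y) (D : unitary_dual R G) (T : intertwiners s D).
Variable c : cochain2 R (dual_groupoid s D).
Hypothesis cP : is_dual_cocycle T c.
Local Notation M := (gM Y).
Local Notation H := (gH Y).
Local Notation Q := (gQ Y).
Local Notation DM := (discrete_topology D * M)%type.
Local Notation DQ := (dual_groupoid s D).
Local Notation deg rho := (rdeg (drepr (rho : D))).

Section Object.
Variable S : twisted_sheaf (@trivial_cocycle R M H).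
Local Notation W := (mult_space S).

Lemma mult_act_subproof (a b : DM) (f : ghom DQ a b) (phi : W b) :
  equivariant (S := S) (a := a) (fun i =>
    mxact (T _ _ _ _ _ (darrow_act f))^T
      (fun j => tact (s _ _ (darrow f)) (phi j)) i).
Proof.
move=> g i; have [k <-] := Ad_surj s (darrow f) g.
rewrite tact_mxact.
transitivity (mxact (T _ _ _ _ _ (darrow_act f))^T
    (fun j => mxact (drepr (b.1 : D) k)^T
      (fun j => tact (s _ _ (darrow f)) (phi j)) j) i).
  apply: eq_mxact => j.
  by rewrite tactM Ad_swap -tactM mult_equivariant tact_mxact.
by rewrite -!mxactM -!trmx_mul itw_swap.
Qed.

(** The arrow [([rho], q)] sends [phi] to [sigma(q) o phi o T_q^rho]. *)
Definition mult_act (a b : DM) (f : ghom DQ a b) (phi : W b) : W a :=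
  MultSpace (@mult_act_subproof a b f phi).

Lemma mult_actE (rho rho' : D) (x y : M) (f : ghom DQ (rho, x) (rho', y))
    (q : ghom Q x y) (e : dact s q rho = rho') (phi : W (rho', y)) i :
  darrow f = q ->
  mult_act f phi i =
  mxact (T _ _ _ _ _ e)^T (fun j => tact (s _ _ q) (phi j)) i.
Proof. by move=> fq; subst q; rewrite /= (itw_eq T _ e). Qed.

Lemma mult_act_linear (a b : DM) (f : ghom DQ a b) k (u v : W b) :
  mult_act f (k *: u + v) = k *: mult_act f u + mult_act f v.
Proof.
apply: mult_space_eq => i; rewrite mult_spaceD mult_spaceZ.
etransitivity; last exact: mxact_linear.
by apply: eq_mxact => j; rewrite mult_spaceD mult_spaceZ tact_linear.
Qed.

Lemma mult_act_id (a : DM) (u : W a) : mult_act (gid DQ a) u = u.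
Proof.
apply: mult_space_eq => i.
have e : darrow (gid DQ a) = gid Q a.2 by exact: darrowK.
rewrite /= (itw_unit T _ e) trmx1 mxact1 e gsec_id.
exact: tact_id.
Qed.

Lemma mult_act_comp (x y z : DM) (f : ghom DQ x y) (g : ghom DQ y z) (u : W z) :
  mult_act f (mult_act g u) = c f g *: mult_act (gcomp f g) u.
Proof.
apply: mult_space_eq => i; rewrite mult_spaceZ.
have [_ ec] := cP f g.
set psi := fun j => tact (s _ _ (gcomp (darrow f) (darrow g))) (u j).
have es : darrow (gcomp f g : ghom DQ x z) = gcomp (darrow f) (darrow g).
  exact: darrowK.
pose tu := tau s (darrow f) (darrow g).
have E j : tact (gi x.2 tu) (mult_act (gcomp f g) u j) =
    mxact (drepr (x.1 : D) tu)^T (mult_act (gcomp f g) u) j.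
  exact: mult_equivariant.
transitivity (mxact (T _ _ _ _ _ (darrow_act g) *m T _ _ _ _ _ (darrow_act f))^T
   (fun j => tact (gi x.2 tu) (psi j)) i).
  rewrite trmx_mul mxactM; apply: eq_mxact => j.
  rewrite [LHS]tact_mxact; apply: eq_mxact => k.
  by rewrite /psi tactM tactM -tau_swap.
rewrite ec linearZ /= mxactZ trmx_mul mxactM; congr (_ *: _).
transitivity (mxact (invmx (drepr (x.1 : D) tu))^T
    (fun j => tact (gi x.2 tu) (mult_act (gcomp f g) u j)) i).
  apply: eq_mxact => j; rewrite -tact_mxact; congr tact.
  by apply: eq_mxact => k; rewrite /psi -es.
rewrite (eq_mxact _ E) -mxactM -trmx_mul.
by rewrite repr_mulV trmx1 mxact1.
Qed.

(** In terms of a section [t], with a free name [rho'] for [q([rho])]. *)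
Lemma mult_act_slice (t : forall a, W a) (rho rho' : D) (q : arr Q)
    (e : dact s (as_hom q) rho = rho') (i : 'I_(deg rho)) :
  mult_act (as_hom ((rho, q) : arr DQ)) (t (tgt ((rho, q) : arr DQ))) i =
  mxact (T _ _ _ _ _ e)^T
    (fun j => tact (s _ _ (as_hom q)) (t (rho', tgt q) j)) i.
Proof.
subst rho'; apply: (@mult_actE rho (dact s (as_hom q) rho) (src q) (tgt q)).
by apply: homset_inj; rewrite sval_darrow.
Qed.

Lemma mult_act_continuous :
  continuous (fun p : eact_space DQ (mult_bundle D S) =>
    germ (S := mult_bundle D S) (mult_act (as_hom (projT1 p)) (projT2 p)) :
      espace (mult_bundle D S)).
Proof.
have shS := tsheafP S.
apply: (@continuous_actionP R DM DQ (mult_bundle D S) (@mult_act)).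
  exact: mult_bundle_sheaf.
move=> t [rho q0] /mult_bundleP ct.
apply: (@continuous_slice D (arr Q)).
set rho1 : D := dact s (as_hom q0) rho.
apply: (@mult_lift R G Y D S (arr Q) rho (@src _ Q)).
  exact: srcQ_continuous.
move=> i.
have ne : \forall q \near q0, exists e : dact s (as_hom q) rho = rho1,
    T _ _ _ _ _ e = T _ _ _ _ _ (erefl rho1).
  exact: itw_locally_constant.
apply: (@continuous_lift_eq _ _ _ _ _ (fun q : arr Q =>
  mxact (T _ _ _ _ _ (erefl rho1))^T
    (fun j => tact (s _ _ (as_hom q)) (t (rho1, tgt q) j)) i)).
  by apply: filterS ne => q [e eT]; rewrite (mult_act_slice t e) eT.
apply: (continuous_lift_sum shS) => [|j]; first exact: srcQ_continuous.
apply: (continuous_liftZ shS).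
apply: continuous_lift_tact; first exact: gsec_continuous.
apply: (@continuous_lift_section _ _ S _ (@tgt M Q)
  (fun y => t (rho1, y) j) q0 (ct j)).
exact: tgtQ_continuous.
Qed.

(** The twisted sheaf [F(S)] on the dual groupoid. *)
Definition mult_sheaf : twisted_sheaf c :=
  @TwistedSheaf R DM DQ c (mult_bundle D S) (mult_bundle_sheaf D S)
    mult_act mult_act_linear mult_act_id mult_act_comp mult_act_continuous.

End Object.

Section Morphism.
Variables S S' : twisted_sheaf (@trivial_cocycle R M H).
Variable f : tsheaf_hom S S'.

Lemma mult_map_subproof (a : DM) (phi : mult_space S a) :
  equivariant (S := S') (a := a) (fun i => f _ (phi i)).
Proof. by move=> g i; rewrite -tmap_act mult_equivariant tmap_mxact. Qed.

Definition mult_map (a : DM) (phi : mult_space S a) : mult_space S' a :=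
  MultSpace (@mult_map_subproof a phi).

Lemma mult_map_linear (a : DM) k (u v : mult_space S a) :
  mult_map (k *: u + v) = k *: mult_map u + mult_map v.
Proof.
apply: mult_space_eq => i.
rewrite [RHS]mult_spaceD mult_spaceZ.
transitivity (f a.2 ((k *: u + v) i)) => //.
by rewrite mult_spaceD mult_spaceZ tmap_linear.
Qed.

Lemma mult_map_act (a b : DM) (k : ghom DQ a b) (u : mult_space S b) :
  mult_map (mult_act k u) = mult_act k (mult_map u).
Proof.
apply: mult_space_eq => i; rewrite /= tmap_mxact.
by apply: eq_mxact => j; rewrite tmap_act.
Qed.

Lemma mult_map_continuous : continuous (fun e : espace (mult_bundle D S) =>
  germ (S := mult_bundle D S') (mult_map (projT2 e)) : espace (mult_bundle D S')).
Proof.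
apply: continuous_espaceP; first exact: mult_bundle_sheaf.
move=> t a /mult_bundleP ct.
apply/(mult_bundleP (fun a => mult_map (t a))) => i.
by apply: tmap_lift; exact: ct.
Qed.

Definition mult_hom : tsheaf_hom (mult_sheaf S) (mult_sheaf S') :=
  @TSheafHom R DM DQ c (mult_sheaf S) (mult_sheaf S')
    mult_map mult_map_linear mult_map_act mult_map_continuous.

End Morphism.

Program Definition mult_functor :
    additive_functor (sheaves R H) (twisted_sheaves c) :=
  @AdditiveFunctor (sheaves R H) (twisted_sheaves c) mult_sheaf mult_hom _ _ _.
Next Obligation.
by move=> S; apply: tsheaf_hom_eq => a u; apply: mult_space_eq.
Qed.
Next Obligation.
by move=> S1 S2 S3 g f; apply: tsheaf_hom_eq => a u; apply: mult_space_eq.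
Qed.
Next Obligation.
move=> S1 S2 f g; apply: tsheaf_hom_eq => a u; apply: mult_space_eq => i.
by rewrite mult_spaceD.
Qed.

End MultiplicityFunctor.

(** * Direct sums over the dual of G *)

Section InducedSpace.
Variables (R : realType) (G : finGroupType) (Y : gerbe_presentation R G).
Variables (D : unitary_dual R G).
Local Notation M := (gM Y).
Local Notation DM := (discrete_topology D * M)%type.
Local Notation deg rho := (rdeg (drepr (rho : D))).
Variable E : bundle R DM.

(** [(+)_rho V_rho (x) E_(rho,x)], given by coordinates in the bases of the
    spaces [V_rho]. *)
Definition ind_space (x : M) : Type :=
  forall (rho : D) (i : 'I_(deg rho)), stalk E (rho, x).

Section Lmodule.
Variable x : M.
Implicit Types u v w : ind_space x.

Lemma ind_space_eq u v : (forall rho i, u rho i = v rho i) -> u = v.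
Proof.
move=> uv; apply: functional_extensionality_dep => rho.
exact: functional_extensionality_dep.
Qed.

Definition ind_zero : ind_space x := fun _ _ => 0.
Definition ind_add u v : ind_space x := fun rho i => u rho i + v rho i.
Definition ind_opp u : ind_space x := fun rho i => - u rho i.
Definition ind_scale (b : R[i]) u : ind_space x := fun rho i => b *: u rho i.

Lemma ind_addA : associative ind_add.
Proof. by move=> u v w; apply: ind_space_eq => rho i; exact: addrA. Qed.
Lemma ind_addC : commutative ind_add.
Proof. by move=> u v; apply: ind_space_eq => rho i; exact: addrC. Qed.
Lemma ind_add0 : left_id ind_zero ind_add.
Proof. by move=> u; apply: ind_space_eq => rho i; exact: add0r. Qed.
Lemma ind_addN : left_inverse ind_zero ind_opp ind_add.
Proof. by move=> u; apply: ind_space_eq => rho i; exact: addNr. Qed.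

HB.instance Definition _ := gen_eqMixin (ind_space x).
HB.instance Definition _ := gen_choiceMixin (ind_space x).
HB.instance Definition _ := GRing.isZmodule.Build (ind_space x)
  ind_addA ind_addC ind_add0 ind_addN.

Lemma ind_scaleA a b u : ind_scale a (ind_scale b u) = ind_scale (a * b) u.
Proof. by apply: ind_space_eq => rho i; exact: scalerA. Qed.
Lemma ind_scale1 : left_id 1 ind_scale.
Proof. by move=> u; apply: ind_space_eq => rho i; exact: scale1r. Qed.
Lemma ind_scaleDr : right_distributive ind_scale +%R.
Proof. by move=> b u v; apply: ind_space_eq => rho i; exact: scalerDr. Qed.
Lemma ind_scaleDl u : {morph ind_scale^~ u : a b / a + b}.
Proof. by move=> a b; apply: ind_space_eq => rho i; exact: scalerDl. Qed.

HB.instance Definition _ := GRing.Zmodule_isLmodule.Build R[i] (ind_space x)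
  ind_scaleA ind_scale1 ind_scaleDr ind_scaleDl.

Lemma ind_spaceD u v rho i : (u + v) rho i = u rho i + v rho i.
Proof. by []. Qed.
Lemma ind_spaceZ a u rho i : (a *: u) rho i = a *: u rho i.
Proof. by []. Qed.

Lemma ind_space_mxact m n (A : 'M[R[i]]_(m, n)) 
    (phi : 'I_n -> ind_space x) i rho k :
  mxact A phi i rho k = mxact A (fun j => phi j rho k) i.
Proof.
rewrite /mxact; elim: (index_enum _) => [|j r IH]; first by rewrite !big_nil.
by rewrite !big_cons ind_spaceD ind_spaceZ IH.
Qed.

End Lmodule.

(** A section is admissible when its coordinates are continuous. *)
Definition ind_section (t : forall x, ind_space x) (x : M) : Prop :=
  forall (rho : D) (i : 'I_(deg rho)),
    continuous_lift (S := E) (b := fun y : M => (rho, y) : DM)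
      (fun y => t y rho i) x.

Hypothesis shE : is_sheaf E.

Let slice_cont (rho : D) : continuous (fun y : M => (rho, y) : DM).
Proof. by move=> x; apply: slice_continuous; exact: cvg_id. Qed.

Lemma ind_system : section_system ind_section.
Proof.
split.
- move=> x w.
  have /all_sig[t tP] (k : {rho : D & 'I_(deg rho)}) :=
    cid (section_through shE (w (tag k) (tagged k))).
  exists (fun y rho i => t (Tagged (fun rho : D => 'I_(deg rho)) i) (rho, y)).
  split.
    move=> rho i; apply: (@continuous_lift_section _ _ E _ (fun y => (rho, y) : DM)
      (t (Tagged (fun rho : D => 'I_(deg rho)) i))); last exact: slice_cont.
    by have [_ /nbhs_singleton] := tP (Tagged (fun rho : D => 'I_(deg rho)) i).
  apply: ind_space_eq => rho i.
  by have [] := tP (Tagged (fun rho : D => 'I_(deg rho)) i).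
- move=> t x Pt; apply: near_forall => rho /=; apply: near_forall => i /=.
  exact: (continuous_lift_near shE (@slice_cont rho) (Pt rho i)).
- move=> t t' x Pt Pt' e.
  have : \forall y \near x, forall (rho : D) (i : 'I_(deg rho)),
      t y rho i = t' y rho i.
    apply: near_forall => rho /=; apply: near_forall => i /=.
    apply: (continuous_lift_uniq shE (Pt rho i) (Pt' rho i)).
    by rewrite e.
  by apply: filterS => y; exact: ind_space_eq.
- move=> t t' x e Pt rho i.
  by apply: continuous_lift_eq (Pt rho i); apply: filterS e => y ->.
- move=> t t' x Pt Pt' rho i.
  exact: (continuous_liftD shE (Pt rho i) (Pt' rho i)).
- move=> b t x Pt rho i.
  exact: (continuous_liftZ shE (a := b) (Pt rho i)).
Qed.

Definition ind_bundle : bundle R M := section_bundle ind_section.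

Lemma ind_bundle_sheaf : is_sheaf ind_bundle.
Proof. exact: section_bundle_sheaf ind_system. Qed.

Lemma ind_bundleP (t : forall x, ind_space x) x :
  section_at (S := ind_bundle) t x <-> ind_section t x.
Proof. exact: section_bundleP ind_system _ _. Qed.

Lemma ind_lift (Z : topologicalType) (b : Z -> M)
    (h : forall z, ind_space (b z)) z :
  {for z, continuous b} ->
  (forall (rho : D) (i : 'I_(deg rho)),
    continuous_lift (S := E) (b := fun z => (rho, b z) : DM)
      (fun z => h z rho i) z) ->
  continuous_lift (S := ind_bundle) h z.
Proof.
move=> cb ch; have [t [Pt e]] := system_through ind_system (h z).
apply: (continuous_lift_eq _ (continuous_lift_section (S := ind_bundle)
   ((ind_bundleP t (b z)).2 Pt) cb)).
have : \forall z' \near z, forall (rho : D) (i : 'I_(deg rho)),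
    t (b z') rho i = h z' rho i.
  apply: near_forall => rho /=; apply: near_forall => i /=.
  apply: (continuous_lift_uniq shE) (ch rho i) _; last by rewrite e.
  exact: (continuous_comp cb (Pt rho i)).
by apply: filterS => z'; exact: ind_space_eq.
Qed.

End InducedSpace.

(** * The functor from twisted sheaves to sheaves on the gerbe *)

Section InducedFunctor.
Variables (R : realType) (G : finGroupType) (Y : gerbe_presentation R G).
Variables (s : gerbe_section Y) (D : unitary_dual R G) (T : intertwiners s D).
Variable c : cochain2 R (dual_groupoid s D).
Hypothesis cP : is_dual_cocycle T c.
Local Notation M := (gM Y).
Local Notation H := (gH Y).
Local Notation Q := (gQ Y).
Local Notation DM := (discrete_topology D * M)%type.
Local Notation DQ := (dual_groupoid s D).
Local Notation deg rho := (rdeg (drepr (rho : D))).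
Local Notation Tw e := (T _ _ _ _ _ e).

(** The arrow [([rho], q)] of the dual groupoid, with a free name [rho'] for
    [q([rho])]. *)
Definition dual_arrow (rho rho' : D) x y (q : ghom Q x y)
    (e : dact s q rho = rho') :
    ghom DQ ((rho, x) : DM) ((rho', y) : DM) :=
  @dhom_of R G Y s D (rho, x) (rho', y) q e.

Lemma dual_arrow_comp (rho rho1 rho2 : D) x y z
    (q1 : ghom Q x y) (q2 : ghom Q y z)
    (e1 : dact s q1 rho = rho1) (e2 : dact s q2 rho1 = rho2)
    (e12 : dact s (gcomp q1 q2) rho = rho2) :
  gcomp (dual_arrow e1) (dual_arrow e2) = dual_arrow e12.
Proof. by apply: darrow_inj; rewrite !darrowK. Qed.

(** The defining relation of [c], solved for the inverses of the intertwiners. *)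
Lemma dual_cocycleE (rho rho1 rho2 : D) x y z
    (q1 : ghom Q x y) (q2 : ghom Q y z)
    (e1 : dact s q1 rho = rho1) (e2 : dact s q2 rho1 = rho2)
    (e12 : dact s (gcomp q1 q2) rho = rho2) :
  c (dual_arrow e1) (dual_arrow e2) *: ((Tw e1) ^t* *m (Tw e2) ^t*) =
  drepr rho (tau s q1 q2) *m (Tw e12) ^t*.
Proof.
have [_] := cP (dual_arrow e1) (dual_arrow e2).
have k1 : darrow (dual_arrow e1) = q1 by exact: darrowK.
have k2 : darrow (dual_arrow e2) = q2 by exact: darrowK.
rewrite (itw_eq T _ e1 k1) (itw_eq T _ e2 k2) k1 k2 /=.
rewrite (itw_eq T _ e12); last first.
  by rewrite [LHS]darrowK k1 k2.
set k := c _ _ => eT.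
have eV : (Tw e1) ^t* *m (Tw e2) ^t* *m (Tw e2 *m Tw e1) = 1%:M.
  by rewrite !mulmxA -(mulmxA (_ ^t*)) itwV mulmx1 itwV.
rewrite eT in eV.
rewrite -scalemxAr in eV.
rewrite -[LHS]mulmx1 -(itwK T e12) mulmxA; congr (_ *m _).
rewrite -[RHS]mul1mx -eV -!scalemxAl; congr (_ *: _).
by rewrite -!mulmxA reprV_mul mulmx1.
Qed.

Lemma fibre_elt_comp x y z (h1 : ghom H x y) (h2 : ghom H y z) :
  fibre_elt s (gcomp h1 h2) =
  (fibre_elt s h1 * Ad s (gj h1) (fibre_elt s h2) * tau s (gj h1) (gj h2))%g.
Proof.
apply: fibre_elt_uniq; rewrite gj_comp !giM -gcompA tau_swap.
rewrite !gcompA -(gcompA (gi x (fibre_elt s h1))) Ad_swap !gcompA fibre_eltE.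
by rewrite -gcompA fibre_eltE.
Qed.

Section Object.
Variable E : twisted_sheaf c.
Local Notation W := (ind_space E).

(** The arrow [g sigma(q)] of [H] sends [v (x) e] to
    [rho(g) (T_q^rho)^-1 v (x) q e]. The component [rho] of the result comes from
    the component [q([rho])] of the argument. *)
Definition ind_act x y (h : ghom H x y) (w : W y) : W x := fun rho =>
  mxact (drepr rho (fibre_elt s h) *m (Tw (erefl (dact s (gj h) rho))) ^t*)
    (fun l => tact (dual_arrow (erefl (dact s (gj h) rho))) (w _ l)).

Lemma ind_actE x y (h : ghom H x y) (w : W y) g (q : ghom Q x y) (rho rho' : D)
    (e : dact s q rho = rho') i :
  fibre_elt s h = g -> gj h = q ->
  ind_act h w i = mxact (drepr rho g *m (Tw e) ^t*)
    (fun l => tact (dual_arrow e) (w rho' l)) i.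
Proof. by move=> gE qE; subst g q rho'. Qed.

Lemma ind_act_linear x y (h : ghom H x y) k (u v : W y) :
  ind_act h (k *: u + v) = k *: ind_act h u + ind_act h v.
Proof.
apply: ind_space_eq => rho i; rewrite ind_spaceD ind_spaceZ.
etransitivity; last exact: mxact_linear.
by apply: eq_mxact => j; rewrite ind_spaceD ind_spaceZ tact_linear.
Qed.

Lemma fibre_elt_gi x g : fibre_elt s (gi x g) = g.
Proof. by apply: fibre_elt_uniq; rewrite gj_gi gsec_id gcompg1. Qed.

Lemma ind_act_gi x g (w : W x) rho i :
  ind_act (gi x g) w i = mxact (drepr rho g) (w rho) i.
Proof.
rewrite (ind_actE _ (dact_id s x rho) _ (fibre_elt_gi x g) (gj_gi x g)).
rewrite itw_id trmx1 map_mx1 mulmx1; apply: eq_mxact => l.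
exact: (tact_id (t := E) (w rho l)).
Qed.

Lemma ind_act_id x (w : W x) : ind_act (gid H x) w = w.
Proof.
apply: ind_space_eq => rho i.
by rewrite -gi1 ind_act_gi repr_mx1 mxact1.
Qed.

Lemma ind_act_comp x y z (h1 : ghom H x y) (h2 : ghom H y z) (w : W z) :
  ind_act h1 (ind_act h2 w) =
  trivial_cocycle R h1 h2 *: ind_act (gcomp h1 h2) w.
Proof.
rewrite scale1r; apply: ind_space_eq => rho i.
set rho1 := dact s (gj h1) rho; set rho2 := dact s (gj h2) rho1.
have e12 : dact s (gcomp (gj h1) (gj h2)) rho = rho2 by exact: dact_comp.
rewrite (ind_actE _ e12 _ (fibre_elt_comp h1 h2) (gj_comp h1 h2)).
rewrite repr_mxM ?inE // repr_mxM ?inE // -!mulmxA.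
rewrite -(dual_cocycleE (erefl rho1) (erefl rho2) e12).
rewrite -!scalemxAr mxactZ.
transitivity (mxact (drepr rho (fibre_elt s h1) *m (Tw (erefl rho1)) ^t*)
  (mxact (drepr rho1 (fibre_elt s h2) *m (Tw (erefl rho2)) ^t*)
    (fun l => c (dual_arrow (erefl rho1)) (dual_arrow (erefl rho2)) *:
       tact (dual_arrow e12) (w rho2 l))) i).
  apply: eq_mxact => j; rewrite [LHS]tact_mxact; apply: eq_mxact => l.
  by rewrite tact_comp (dual_arrow_comp _ _ e12).
rewrite -mxactM mxact_scale; congr (_ *: mxact _ _ _).
by rewrite -!mulmxA; congr (_ *m _); rewrite !mulmxA itwV_swap.
Qed.

(** In terms of a section [t]. The coordinates of [t] in the component [rho'] are
    extended by zero, so that the arrow on the right needs no transport along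
    [e]. *)
Lemma ind_act_slice (t : forall y, W y) x y (h : ghom H x y) g (rho rho' : D)
    (e : dact s (gj h) rho = rho') i :
  fibre_elt s h = g ->
  ind_act h (t y) i = mxact (drepr rho g *m (Tw e) ^t*)
    (fun l => tact (dual_arrow (erefl (dact s (gj h) rho)))
       (extend_slice (V := fun a => stalk E a) (fun y' => t y' rho' l)
          (dact s (gj h) rho, y))) i.
Proof.
move=> gE; subst g rho'; apply: eq_mxact => l.
by congr tact; rewrite extend_sliceE.
Qed.

Lemma itw_as_hom x y (q : ghom Q x y) (rho rho' : D) A :
  (exists e : dact s (as_hom (sval q)) rho = rho', Tw e = A) ->
  exists e : dact s q rho = rho', Tw e = A.
Proof. by case: q => q [/= e1 e2]; subst. Qed.

Lemma itw_gj_locally_constant (rho : D) (h0 : arr H) :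
  \forall h \near h0, exists e :
    dact s (gj (as_hom h)) rho = dact s (gj (as_hom h0)) rho,
    Tw e = Tw (erefl (dact s (gj (as_hom h0)) rho)).
Proof.
have e0 := dact_as_hom s (gj (as_hom h0)) rho.
have [e1 E1] := itw_as_hom (ex_intro _ e0 (erefl (Tw e0))).
rewrite (itw_eq T (erefl _) e1 erefl) E1.
have n : \forall h \near h0, exists e :
    dact s (as_hom (sval (gj (as_hom h)))) rho = dact s (gj (as_hom h0)) rho,
    Tw e = Tw e0.
  exact: (@gj_continuous R G Y h0 _ (itw_locally_constant T e0)).
by apply: filterS n => h /itw_as_hom.
Qed.

Lemma ind_act_continuous : continuous (fun p : eact_space H (ind_bundle E) =>
  germ (S := ind_bundle E) (ind_act (as_hom (projT1 p)) (projT2 p)) :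
    espace (ind_bundle E)).
Proof.
have shE := tsheafP E.
apply: (@continuous_actionP R M H (ind_bundle E) (@ind_act)).
  exact: ind_bundle_sheaf.
move=> t h0 /(ind_bundleP shE) ct.
apply: (ind_lift shE); first exact: srcH_continuous.
move=> rho i; set rho1 := dact s (gj (as_hom h0)) rho.
have ne := itw_gj_locally_constant rho h0; rewrite -/rho1 in ne.
have ng := fibre_elt_locally_constant s h0.
pose b (h : arr H) : DM := (dact s (gj (as_hom h)) rho, tgt h).
have cb : {for h0, continuous b}.
  move=> U nU.
  have nU' := tgtH_continuous (near_sliceP (Q := U) nU).
  by apply: filterS2 ne nU' => h [e _]; rewrite /b /= e.
have csrc : {for h0, continuous (fun h : arr H => (rho, src h) : DM)}.
  by apply: slice_continuous; exact: srcH_continuous.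
apply: (@continuous_lift_eq _ _ _ _ _ (fun h : arr H =>
  mxact (drepr rho (fibre_elt s (as_hom h0)) *m (Tw (erefl rho1)) ^t*)
    (fun l => tact (dual_arrow (erefl (dact s (gj (as_hom h)) rho)))
       (extend_slice (V := fun a => stalk E a) (fun y' => t y' rho1 l)
          (b h))) i)).
  by apply: filterS2 ne ng => h [e eT] gE; rewrite (ind_act_slice t e i gE) eT.
apply: (continuous_lift_sum shE) => // l.
apply: (continuous_liftZ shE).
apply: (@continuous_lift_tact _ _ _ _ E _
  (fun h : arr H => (rho, src h) : DM) b).
  apply: (@slice_continuous D _ _ (fun h => sval (gj (as_hom h))) rho).
  exact: gj_continuous.
apply: (@continuous_lift_section _ _ E _ b) => //.
apply: continuous_slice.
apply: continuous_lift_eq (ct rho1 l).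
by apply: nearW => y; rewrite extend_sliceE.
Qed.

(** The sheaf [G(E)] on the gerbe. *)
Definition ind_sheaf : twisted_sheaf (@trivial_cocycle R M H) :=
  @TwistedSheaf R M H _ (ind_bundle E) (ind_bundle_sheaf (tsheafP E))
    ind_act ind_act_linear ind_act_id ind_act_comp ind_act_continuous.

End Object.

Section Morphism.
Variables E E' : twisted_sheaf c.
Variable f : tsheaf_hom E E'.

Definition ind_map x (w : ind_space E x) : ind_space E' x :=
  fun rho i => f _ (w rho i).

Lemma ind_map_linear x k (u v : ind_space E x) :
  ind_map (k *: u + v) = k *: ind_map u + ind_map v.
Proof. by apply: ind_space_eq => rho i; exact: tmap_linear. Qed.

Lemma ind_map_act x y (h : ghom H x y) (w : ind_space E y) :
  ind_map (ind_act h w) = ind_act h (ind_map w).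
Proof.
apply: ind_space_eq => rho i; rewrite [LHS]tmap_mxact.
by apply: eq_mxact => l; rewrite tmap_act.
Qed.

Lemma ind_map_continuous : continuous (fun e : espace (ind_bundle E) =>
  germ (S := ind_bundle E') (ind_map (projT2 e)) : espace (ind_bundle E')).
Proof.
apply: continuous_espaceP; first exact: (ind_bundle_sheaf (tsheafP E)).
move=> t x /(ind_bundleP (tsheafP E)) ct.
apply/(ind_bundleP (tsheafP E') (fun x => ind_map (t x))) => rho i.
by apply: tmap_lift; exact: ct.
Qed.

Definition ind_hom : tsheaf_hom (ind_sheaf E) (ind_sheaf E') :=
  @TSheafHom R M H _ (ind_sheaf E) (ind_sheaf E')
    ind_map ind_map_linear ind_map_act ind_map_continuous.

End Morphism.

Program Definition ind_functor :
    additive_functor (twisted_sheaves c) (sheaves R H) :=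
  @AdditiveFunctor (twisted_sheaves c) (sheaves R H) ind_sheaf ind_hom _ _ _.
Next Obligation. by move=> E; exact: tsheaf_hom_eq. Qed.
Next Obligation. by move=> E1 E2 E3 g f; exact: tsheaf_hom_eq. Qed.
Next Obligation. by move=> E1 E2 f g; exact: tsheaf_hom_eq. Qed.

End InducedFunctor.

(** * The natural isomorphism on the side of the gerbe *)

Section Counit.
Variables (R : realType) (G : finGroupType) (Y : gerbe_presentation R G).
Variables (s : gerbe_section Y) (D : unitary_dual R G) (T : intertwiners s D).
Variable c : cochain2 R (dual_groupoid s D).
Hypothesis cP : is_dual_cocycle T c.
Local Notation M := (gM Y).
Local Notation H := (gH Y).
Local Notation Q := (gQ Y).
Local Notation DM := (discrete_topology D * M)%type.
Local Notation DQ := (dual_groupoid s D).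
Local Notation deg rho := (rdeg (drepr (rho : D))).
Local Notation Tw e := (T _ _ _ _ _ e).
Variable S : twisted_sheaf (@trivial_cocycle R M H).
Local Notation FS := (mult_sheaf cP S).
Local Notation GFS := (ind_sheaf cP FS).
Local Notation W := (ind_space FS).

(** With [w] in [(+)_rho V_rho (x) Hom_G(V_rho, S_x)], the coefficient of the
    [i]-th basis vector of [V_rho] is a map [V_rho -> S_x], and [entry w i m] is
    its value at the [m]-th basis vector. *)
Definition entry x (w : W x) (rho : D) (i m : 'I_(deg rho)) : stalk S x :=
  mult_fun (S := S) (a := (rho, x)) (w rho i) m.

(** The evaluation of [V_rho (x) Hom_G(V_rho, S_x)] in [S_x]. *)
Definition counit_map x (w : W x) : stalk S x :=
  \sum_(rho : D) \sum_(i < deg rho) entry w i i.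

Lemma counit_linear x a (u v : W x) :
  counit_map (a *: u + v) = a *: counit_map u + counit_map v.
Proof.
rewrite scaler_sumr -big_split /=; apply: eq_bigr => rho _.
rewrite scaler_sumr -big_split /=; apply: eq_bigr => i _.
by rewrite /entry ind_spaceD ind_spaceZ mult_spaceD mult_spaceZ.
Qed.

Lemma trace_mxact (V : lmodType R[i]) m n p (A : 'M[R[i]]_(m, n))
    (B : 'M[R[i]]_(m, p)) (v : 'I_n -> 'I_p -> V) :
  \sum_i mxact A (fun l => mxact B (v l) i) i =
  \sum_l \sum_j (A^T *m B) l j *: v l j.
Proof.
rewrite exchange_big /=; apply: eq_bigr => l _.
under [RHS]eq_bigr do rewrite mxE scaler_suml.
rewrite exchange_big /=; apply: eq_bigr => i _.
by rewrite scaler_sumr; apply: eq_bigr => j _; rewrite mxE scalerA.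
Qed.

Lemma dact_inj x y (q : ghom Q x y) : injective (@dact R G Y s D x y q).
Proof. exact: can_inj (@dact_inv R G Y s D x y q). Qed.

Lemma counit_act x y (h : ghom H x y) (w : W y) :
  counit_map (ind_act T h w) = tact h (counit_map w).
Proof.
pose q := gj h; have [k kE] := Ad_surj s q (fibre_elt s h).
rewrite /counit_map tact_sum [RHS](reindex_inj (@dact_inj x y q)) /=.
apply: eq_bigr => rho _; set rho' := dact s q rho.
rewrite tact_sum.
transitivity (\sum_i mxact
   (drepr rho (fibre_elt s h) *m (Tw (erefl rho')) ^t*)
   (fun l => mxact (Tw (erefl rho'))^T
      (fun j => tact (s _ _ q) (entry w l j)) i) i).
  apply: eq_bigr => i _.
  rewrite [LHS](mult_space_mxact (a := (rho, x))).
  apply: eq_mxact => l.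
  by apply: mult_actE; exact: darrowK.
rewrite trace_mxact -trmx_mul mulmxA -kE itw_swap -mulmxA itwK mulmx1.
apply: eq_bigr => l _.
transitivity (mxact (drepr rho' k)^T
  (fun j => tact (s _ _ q) (entry w l j)) l) => //.
rewrite -tact_mxact -(mult_equivariant (a := (rho', y))) tactM.
by rewrite -Ad_swap kE fibre_eltE.
Qed.

Lemma counit_continuous : continuous (fun e : espace GFS =>
  germ (counit_map (projT2 e)) : espace S).
Proof.
have shS := tsheafP S.
apply: continuous_espaceP; first exact: (tsheafP GFS).
move=> t x /(ind_bundleP (tsheafP FS)) ct.
have cid : {for x, continuous (fun y : M => y)} by exact: cvg_id.
apply: (continuous_lift_sum shS (b := fun y => y)) => // rho.
apply: (continuous_lift_sum shS (b := fun y => y)) => // i.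
exact: (@mult_lift_component R G Y D S M rho (fun y => y)
  (fun y => t y rho i) x i (ct rho i)).
Qed.

Definition counit : tsheaf_hom GFS S :=
  @TSheafHom R M H _ GFS S
    counit_map counit_linear counit_act counit_continuous.

Local Notation ratio rho := ((deg rho)%:R / #|G|%:R : R[i]).

(** The matrix units of the group algebra of [G], acting on the stalk [S_x]. *)
Definition coeff (rho : D) (i j : 'I_(deg rho)) x (u : stalk S x) : stalk S x :=
  ratio rho *: \sum_g drepr rho g^-1%g i j *: tact (gi x g) u.

Lemma coeff_equivariant (rho : D) (i : 'I_(deg rho)) x (u : stalk S x) :
  equivariant (S := S) (a := (rho, x)) (fun j => coeff i j u).
Proof.
move=> k j /=; rewrite [RHS]mxact_scale tactZ; congr (_ *: _).
rewrite tact_sum [RHS]/mxact.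
under [RHS]eq_bigr do rewrite scaler_sumr.
rewrite exchange_big /= [RHS](reindex_inj (mulgI k)) /=.
apply: eq_bigr => g _; rewrite tactZ tactM -giM.
under eq_bigr do rewrite scalerA mxE.
rewrite -scaler_suml; congr (_ *: _).
transitivity ((drepr rho (k * g)^-1%g *m drepr rho k) i j).
  by rewrite -repr_mxM ?inE // invMg mulgKV.
by rewrite mxE; apply: eq_bigr => l _; rewrite mulrC.
Qed.

Definition counit_inv x (u : stalk S x) : W x :=
  fun rho i => MultSpace (@coeff_equivariant rho i x u).

Lemma counit_invK x : cancel (@counit_inv x) (@counit_map x).
Proof.
move=> u; rewrite /counit_map /=.
transitivity (\sum_g (\sum_(rho : D) ratio rho * \tr (drepr rho g^-1%g)) *:
   tact (gi x g) u).
  under [RHS]eq_bigr do rewrite scaler_suml.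
  rewrite exchange_big /=; apply: eq_bigr => rho _.
  under [RHS]eq_bigr do rewrite -scalerA scaler_suml scaler_sumr.
  rewrite exchange_big /=; apply: eq_bigr => i _.
  by rewrite [LHS]scaler_sumr.
rewrite (bigD1 1%g) //= sum_characters eqxx scale1r gi1 big1.
  by rewrite addr0; exact: tact_id.
by move=> g /negPf g1; rewrite sum_characters g1 scale0r.
Qed.

Lemma counitK x : cancel (@counit_map x) (@counit_inv x).
Proof.
move=> w; apply: ind_space_eq => rho' k.
apply: (mult_space_eq (a := (rho', x))) => j.
rewrite [LHS]/= /coeff /counit_map.
have G0 : #|G|%:R != 0 :> R[i].
  by rewrite pnatr_eq0 -lt0n; apply/card_gt0P; exists 1%g.
have d0 : (deg rho')%:R != 0 :> R[i] by rewrite pnatr_eq0 -lt0n deg_gt0.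
transitivity (ratio rho' *: \sum_(rho : D) \sum_i \sum_m
  (\sum_g drepr rho g m i * drepr rho' g^-1%g k j) *: entry w i m).
  congr (_ *: _).
  under eq_bigr do rewrite tact_sum scaler_sumr.
  rewrite exchange_big /=; apply: eq_bigr => rho _.
  under eq_bigr do rewrite tact_sum scaler_sumr.
  rewrite exchange_big /=; apply: eq_bigr => i _.
  under [RHS]eq_bigr do rewrite scaler_suml.
  rewrite [RHS]exchange_big /=; apply: eq_bigr => g _.
  rewrite (mult_equivariant (a := (rho, x))) scaler_sumr.
  by apply: eq_bigr => m _; rewrite scalerA mxE mulrC.
rewrite (bigD1 rho') //= [X in _ + X]big1 => [|rho neq]; last first.
  apply: big1 => i _; apply: big1 => m _.
  by rewrite schur_orthogonality_neq // scale0r.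
rewrite addr0 (bigD1 k) //= [X in _ + X]big1 => [|i /negPf ik]; last first.
  apply: big1 => m _.
  by rewrite schur_orthogonality ik mulr0 scale0r.
rewrite addr0 (bigD1 j) //= [X in _ + X]big1 => [|m /negPf mj]; last first.
  by rewrite schur_orthogonality mj mulr0 mul0r scale0r.
rewrite addr0 schur_orthogonality !eqxx !mulr1 scalerA.
by rewrite mulrA mulfVK // mulfV // scale1r.
Qed.

End Counit.

(** * The natural isomorphism on the dual side *)

Section Unit.
Variables (R : realType) (G : finGroupType) (Y : gerbe_presentation R G).
Variables (s : gerbe_section Y) (D : unitary_dual R G) (T : intertwiners s D).
Variable c : cochain2 R (dual_groupoid s D).
Hypothesis cP : is_dual_cocycle T c.
Local Notation M := (gM Y).
Local Notation H := (gH Y).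
Local Notation Q := (gQ Y).
Local Notation DM := (discrete_topology D * M)%type.
Local Notation DQ := (dual_groupoid s D).
Local Notation deg rho := (rdeg (drepr (rho : D))).
Local Notation Tw e := (T _ _ _ _ _ e).
Variable E : twisted_sheaf c.
Local Notation GE := (ind_sheaf cP E).
Local Notation FGE := (mult_sheaf cP GE).
Local Notation W := (ind_space E).

(** The tensor [e_i (x) u] in [V_rho (x) E_(rho,x)], where [e_i] is the [i]-th
    basis vector of [V_rho]. *)
Definition pure (rho : D) (i : 'I_(deg rho)) x (u : stalk E (rho, x)) : W x :=
  fun rho' =>
    if pselect (rho = rho') is left e
    then eq_rect rho (fun r : D => 'I_(deg r) -> stalk E (r, x))
           (fun k => (k == i)%:R *: u) rho' e
    else fun=> 0.

Lemma pureE (rho : D) (i k : 'I_(deg rho)) x (u : stalk E (rho, x)) :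
  pure i u k = (k == i)%:R *: u.
Proof.
rewrite /pure; case: pselect => // e.
by rewrite (Prop_irrelevance e erefl).
Qed.

Lemma pure_neq (rho : D) (i : 'I_(deg rho)) x (u : stalk E (rho, x))
    (rho' : D) (k : 'I_(deg rho')) : rho <> rho' -> pure i u k = 0.
Proof. by move=> neq; rewrite /pure; case: pselect. Qed.

Lemma pure_comb (rho : D) x (u : stalk E (rho, x)) m
    (A : 'M[R[i]]_(m, deg rho)) i k :
  mxact A (fun j => pure j u) i rho k = A i k *: u.
Proof.
rewrite ind_space_mxact /mxact (bigD1 k) //= big1 => [|j /negPf jk].
  by rewrite pureE eqxx scale1r addr0.
by rewrite pureE eq_sym jk scale0r scaler0.
Qed.

Lemma pure_comb_neq (rho : D) x (u : stalk E (rho, x)) m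
    (A : 'M[R[i]]_(m, deg rho)) i (rho' : D) (k : 'I_(deg rho')) :
  rho <> rho' -> mxact A (fun j => pure j u) i rho' k = 0.
Proof.
move=> neq; rewrite ind_space_mxact /mxact big1 // => j _.
by rewrite pure_neq // scaler0.
Qed.

Lemma pure_linear (rho : D) (i : 'I_(deg rho)) x a (u v : stalk E (rho, x)) :
  pure i (a *: u + v) = a *: pure i u + pure i v.
Proof.
apply: ind_space_eq => rho' k; rewrite ind_spaceD ind_spaceZ.
have [e|neq] := pselect (rho = rho'); last first.
  by rewrite !pure_neq // scaler0 addr0.
by subst rho'; rewrite !pureE scalerDr !scalerA mulrC.
Qed.

Lemma mxact0 (V : lmodType R[i]) m n (A : 'M[R[i]]_(m, n)) i :
  mxact A (fun _ => 0 : V) i = 0.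
Proof. by rewrite /mxact big1 // => j _; rewrite scaler0. Qed.

Lemma pure_equivariant (rho : D) x (u : stalk E (rho, x)) :
  equivariant (S := GE) (a := (rho, x)) (fun i => pure i u).
Proof.
move=> g i; apply: ind_space_eq => rho' k.
rewrite [LHS]ind_act_gi.
have [e|neq] := pselect (rho = rho').
  subst rho'; rewrite [RHS]pure_comb mxE /mxact.
  rewrite (bigD1 i) //= big1 => [|l /negPf li].
    by rewrite pureE eqxx scale1r addr0.
  by rewrite pureE li scale0r scaler0.
rewrite [RHS]pure_comb_neq //.
rewrite -[RHS](mxact0 (stalk E (rho', x)) (drepr rho' g) k).
by apply: eq_mxact => l; rewrite pure_neq.
Qed.

(** The map [u |-> (v |-> v (x) u)]. *)
Definition unit_map (a : DM) : stalk E a -> mult_space GE a :=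
  let: (rho, x) as a' := a return stalk E a' -> mult_space GE a' in
  fun u => MultSpace (@pure_equivariant rho x u).

Lemma unit_linear (a : DM) k (u v : stalk E a) :
  unit_map (k *: u + v) = k *: unit_map u + unit_map v.
Proof.
case: a u v => rho x u v; apply: mult_space_eq => i.
rewrite mult_spaceD mult_spaceZ; exact: pure_linear.
Qed.

Lemma unit_act (a b : DM) (f : ghom DQ a b) (u : stalk E b) :
  unit_map (tact f u) = mult_act T f (unit_map u).
Proof.
case: a b f u => rho x [rho1 y] f u.
have e := darrow_act f; set q := darrow f in e; rewrite /= in e.
have fE : f = dual_arrow e by apply: darrow_inj; rewrite [RHS]darrowK.
apply: mult_space_eq => i; apply: ind_space_eq => rho' k.
pose w : W y := mxact (Tw e)^T (fun j => pure j u) i.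
transitivity (ind_act T (s _ _ q) w k); last first.
  rewrite (mult_actE _ e) //; rewrite -tact_mxact; exact: erefl.
have gE : fibre_elt s (s _ _ q) = 1%g.
  by apply: fibre_elt_uniq; rewrite gsecK gi1 gcomp1g.
have [e'|neq] := pselect (rho = rho').
  subst rho'; rewrite (ind_actE T w e k gE (gsecK s q)) repr_mx1 mul1mx.
  rewrite [LHS]pureE -fE.
  transitivity (mxact ((Tw e) ^t*) (fun l => (Tw e) l i *: tact f u) k);
    last first.
    apply: eq_mxact => l; rewrite /w.
    by rewrite pure_comb mxE -tactZ.
  have -> : (k == i)%:R = (1%:M : 'M[R[i]]_(deg rho)) k i by rewrite mxE.
  rewrite -(itwV T e) /mxact mxE scaler_suml.
  by apply: eq_bigr => l _; rewrite scalerA.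
rewrite [LHS]pure_neq //; apply/esym.
set rho1' := dact s q rho'.
have neq1 : rho1 <> rho1'.
  by move=> e1; apply: neq; apply: (@dact_inj R G Y s D x y q); rewrite e.
rewrite (ind_actE T w (erefl rho1') k gE (gsecK s q)).
rewrite -[RHS](mxact0 (stalk E (rho', x))
  (drepr rho' 1%g *m (Tw (erefl rho1')) ^t*) k).
apply: eq_mxact => l; rewrite /w pure_comb_neq //.
by rewrite -(scale0r (0 : stalk E (rho1', y))) tactZ scale0r.
Qed.

Lemma unit_continuous : continuous (fun e : espace E =>
  germ (S := FGE) (unit_map (projT2 e)) : espace FGE).
Proof.
have shE := tsheafP E.
apply: (continuous_espaceP shE) => t [rho x] ct.
apply/(mult_bundleP (fun a => unit_map (t a))) => i.
apply/(ind_bundleP shE (fun y => unit_map (t (rho, y)) i)) => rho' k.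
have cs r : {for x, continuous (fun y : M => (r, y) : DM)}.
  by apply: slice_continuous; exact: cvg_id.
have [e|neq] := pselect (rho = rho').
  subst rho'.
  have ct' := continuous_lift_section ct (cs rho).
  apply: (continuous_lift_eq _ (continuous_liftZ shE (a := (k == i)%:R) ct')).
  by apply: nearW => y; rewrite [RHS]pureE.
apply: (continuous_lift_eq _ (continuous_lift0 shE (cs rho'))).
by apply: nearW => y; rewrite [RHS]pure_neq.
Qed.

Definition unit_hom : tsheaf_hom E FGE :=
  @TSheafHom R DM DQ c E FGE unit_map unit_linear unit_act unit_continuous.

(** An equivariant map from [V_rho] to [(+)_rho' V_rho' (x) E_(rho',x)] has its
    values in the summand of [rho], where it is [v |-> v (x) u] for a unique
    [u]; this is Schur's lemma with coefficients in [E_(rho',x)]. *)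
Lemma unit_bij (a : DM) : bijective (@unit_map a).
Proof.
case: a => rho x.
have G0 : #|G|%:R != 0 :> R[i].
  by rewrite pnatr_eq0 -lt0n; apply/card_gt0P; exists 1%g.
have d0 : (deg rho)%:R != 0 :> R[i] by rewrite pnatr_eq0 -lt0n deg_gt0.
pose ent (phi : mult_space GE (rho, x)) i (rho' : D) k : stalk E (rho', x) :=
  (mult_fun phi i : W x) rho' k.
exists (fun phi : mult_space GE (rho, x) =>
  (deg rho)%:R^-1 *: \sum_l ent phi l rho l).
  move=> u; rewrite /ent /=.
  under eq_bigr do rewrite pureE eqxx scale1r.
  by rewrite sumr_const card_ord -(scaler_nat _ u) scalerA mulVf // scale1r.
move=> phi; apply: (mult_space_eq (a := (rho, x))) => i.
apply: ind_space_eq => rho' k; rewrite -/(ent phi i rho' k).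
have Eq j g : mxact (drepr rho' g) (ent phi j rho') k =
    mxact (drepr rho g)^T (fun j => ent phi j rho' k) j.
  rewrite -(ind_act_gi T) -ind_space_mxact.
  by rewrite -(mult_equivariant phi g j).
(* Averaging the equivariance relation over [G] brings in the sums of the
   orthogonality relations. *)
have avg : #|G|%:R *: ent phi i rho' k = \sum_j \sum_l
    (\sum_g drepr rho' g k l * drepr rho g^-1%g j i) *: ent phi j rho' l.
  transitivity (\sum_(g : G) mxact (drepr rho g^-1%g)^T
    (fun j => mxact (drepr rho' g) (ent phi j rho') k) i).
    rewrite -sum1_card natr_sum scaler_suml; apply: eq_bigr => g _.
    rewrite (eq_mxact _ (Eq ^~ g)) -mxactM -trmx_mul -repr_mxM ?inE //.
    by rewrite mulgV repr_mx1 trmx1 mxact1 scale1r.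
  rewrite exchange_big /=; apply: eq_bigr => j _.
  under [RHS]eq_bigr do rewrite scaler_suml.
  rewrite [RHS]exchange_big /=; apply: eq_bigr => g _.
  rewrite scaler_sumr; apply: eq_bigr => l _.
  by rewrite scalerA mxE mulrC.
apply: (scalerI G0); rewrite avg.
have [e|neq] := pselect (rho = rho').
  subst rho'; rewrite [in LHS]/= pureE !scalerA.
  rewrite scaler_sumr; apply: eq_bigr => j _.
  rewrite [RHS](bigD1 j) //= [X in _ + X]big1 => [|l /negPf lj]; last first.
    by rewrite schur_orthogonality lj mulr0 scale0r.
  rewrite addr0 schur_orthogonality eqxx mulr1; congr (_ *: _).
  by rewrite mulrAC.
rewrite [in LHS]/= pure_neq // scaler0; apply/esym/big1 => j _.
apply: big1 => l _; rewrite schur_orthogonality_neq ?scale0r //.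
by apply/eqP => e; apply: neq.
Qed.

End Unit.

(** [bijective_is_iso], in the category of twisted sheaves. *)
Lemma bijective_iso (R : realType) (X : topologicalType) (K : groupoid X)
    (c : cochain2 R K) (S S' : twisted_sheaves c) (f : Defs.hom S S') :
  (forall x, bijective (@tmap R X K c S S' f x)) ->
  exists g : Defs.hom S' S, compc g f = idc S /\ compc f g = idc S'.
Proof.
move=> /bijective_is_iso[g [gf fg]]; exists g.
by split; apply: tsheaf_hom_eq => x u; [exact: gf | exact: fg].
Qed.

(** * The equivalence *)

Theorem theorem1p4 (R : realType) (G : finGroupType)
    (Y : gerbe_presentation R G) (s : gerbe_section Y)
    (D : unitary_dual R G) (T : intertwiners s D)
    (c : cochain2 R (dual_groupoid s D)) :
  is_dual_cocycle T c ->
  equivalent (sheaves R (gH Y)) (twisted_sheaves c).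
Proof.
move=> cP; exists (mult_functor cP), (ind_functor cP).
pose A := sheaves R (gH Y); pose B := twisted_sheaves c.
have /all_sig[eta etaP] (X : A) := cid (bijective_iso (f := counit cP X)
  (fun x => Bijective (@counitK R G Y s D T c cP X x)
                      (@counit_invK R G Y s D T c cP X x))).
have /all_sig[eps epsP] (X : B) := cid (bijective_iso (f := unit_hom cP X)
  (@unit_bij R G Y s D T c cP X)).
split.
  exists eta; split=> [X|X X' f]; first by exists (counit cP X); case: (etaP X).
  (* naturality of the inverse follows from that of [counit] *)
  have nat : compc (f : Defs.hom (X : A) X') (counit cP X) =
      compc (counit cP X' : Defs.hom _ (X' : A))
        (Defs.fmap (ind_functor cP) (Defs.fmap (mult_functor cP) f)).
    apply: tsheaf_hom_eq => x w; rewrite /= /counit_map tmap_sum.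
    by apply: eq_bigr => rho _; rewrite tmap_sum.
  have [e1 e2] := etaP X; have [e1' e2'] := etaP X'.
  rewrite -[LHS]comp1c -e1' -compcA; congr compc.
  by rewrite compcA -nat -compcA e2 compc1.
exists eps; split=> [X|X X' f]; first by exists (unit_hom cP X); case: (epsP X).
have nat : compc (unit_hom cP X' : Defs.hom (X' : B) _) f =
    compc (Defs.fmap (mult_functor cP) (Defs.fmap (ind_functor cP) f))
      (unit_hom cP X : Defs.hom (X : B) _).
  apply: tsheaf_hom_eq => -[rho x] u.
  apply: (mult_space_eq (a := (rho, x))) => i; apply: ind_space_eq => rho' k.
  have [e|neq] := pselect (rho = rho').
    by subst rho'; rewrite [LHS]pureE [RHS]/= /ind_map pureE tmapZ.
  by rewrite [LHS]pure_neq // [RHS]/= /ind_map pure_neq // tmap0.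
have [e1 e2] := epsP X; have [e1' e2'] := epsP X'.
rewrite -[LHS]comp1c -e1' -!compcA; congr compc.
by rewrite [in LHS]compcA nat -compcA e2 compc1.
Qed.
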